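(* Let $N$ be a level-$2$ network on $X$ and let $A|B$ be a split of $X$ (a partition of $X$ into two non-empty sets $A$ and $B$). Then $A|B$ is induced by a cut-edge of $N$ if and only if for all $a,a'\in A$ and $b,b'\in B$: (i) $d_m(a,b)+d_m(a',b')=d_m(a,b')+d_m(a',b)$; and (ii) $d_m(a,a')+d_m(b,b')\le d_m(a,b)+d_m(a',b')-2$, where $d_m=d^N_m$. In particular, all cut-edge induced splits of $N$ can be determined from its shortest distance matrix $\mathcal{D}_m(N)$.
   Context: A network on a finite set $X$ with $|X|\ge 2$ is a finite, simple, connected, undirected, unweighted graph with at least two degree-$1$ vertices (leaves), leaves bijectively labelled by $X$, all other vertices of degree $3$. A cut-edge $e$ induces the split $A|B$ where $A$ and $B$ are the sets of leaves in the two components of the graph with $e$ removed. Standing assumption on all networks: every cut-edge separates $X$ into two non-empty parts and distinct cut-edges induce distinct splits. A blob is a maximal $2$-connected subgraph with at least three vertices; a network is level-$2$ if at most $2$ edges must be deleted from every blob to obtain a tree. $d^N_m(x,y)$ is the number of edges of a shortest $x$–$y$ path in $N$, and $\mathcal{D}_m(N)=(d^N_m(x,y))_{x,y\in X}$. *)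

(* Defs.v *)
From mathcomp Require Import all_boot.

Set Implicit Arguments.
Unset Strict Implicit.
Unset Printing Implicit Defensive.

(* Edges are unordered pairs; [is_simple] makes them two-element subsets of
   the vertex set. *)
Record graph (V : finType) := Graph {
  verts : {set V};
  edges : {set {set V}}
}.

Definition is_simple (V : finType) (G : graph V) : Prop :=
  forall e, e \in edges G -> e \subset verts G /\ #|e| = 2.

Definition adj (V : finType) (G : graph V) : rel V :=
  [rel x y | [set x; y] \in edges G].

Definition deg (V : finType) (G : graph V) (v : V) : nat :=
  #|[set e in edges G | v \in e]|.

Definition connected (V : finType) (G : graph V) : bool :=
  (verts G != set0) &&
  [forall x in verts G, forall y in verts G, connect (adj G) x y].

Definition components (V : finType) (G : graph V) : {set {set V}} :=
  [set [set w | connect (adj G) v w] | v in verts G].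

Definition del_edges (V : finType) (G : graph V) (D : {set {set V}}) : graph V :=
  Graph (verts G) (edges G :\: D).

Definition del_vertex (V : finType) (G : graph V) (v : V) : graph V :=
  Graph (verts G :\ v) [set e in edges G | v \notin e].

Definition subgraph (V : finType) (H G : graph V) : Prop :=
  [/\ is_simple H, verts H \subset verts G & edges H \subset edges G].

Definition acyclic (V : finType) (G : graph V) : Prop :=
  forall c : seq V, 3 <= size c -> ~ ucycle (adj G) c.

Definition is_tree (V : finType) (G : graph V) : Prop :=
  connected G /\ acyclic G.

Definition two_connected (V : finType) (G : graph V) : Prop :=
  connected G /\ forall v, v \in verts G -> connected (del_vertex G v).

Definition is_blob (V : finType) (G H : graph V) : Prop :=
  [/\ subgraph H G,
      two_connected H,
      3 <= #|verts H|
    & forall K, subgraph K G -> two_connected K -> subgraph H K -> K = H].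

Definition level_le (V : finType) (k : nat) (G : graph V) : Prop :=
  forall H, is_blob G H ->
    exists D : {set {set V}},
      [/\ D \subset edges H, #|D| <= k & is_tree (del_edges H D)].

Definition cut_edges (V : finType) (G : graph V) : {set {set V}} :=
  [set e in edges G | ~~ connected (del_edges G [set e])].

(* The unordered split A|B is the set [set A; B] of subsets of X. *)
Definition edge_split (X V : finType) (G : graph V) (label : X -> V)
    (e : {set V}) : {set {set X}} :=
  [set label @^-1: C | C : {set V} in components (del_edges G [set e])].

Record network (X : finType) := Network {
  vertex : finType;
  net :> graph vertex;
  label : X -> vertex;
  net_verts : verts net = setT;
  net_simple : is_simple net;
  net_connected : connected net;
  net_labels : 2 <= #|X|;
  net_deg : forall v, deg net v = 1 \/ deg net v = 3;
  label_inj : injective label;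
  label_leaves : forall v, deg net v = 1 <-> exists x, label x = v;
  net_split_nonempty : forall e, e \in cut_edges net ->
    set0 \notin edge_split net label e;
  net_split_inj : {in cut_edges net &, injective (edge_split net label)}
}.

Definition cut_splits (X : finType) (N : network X) : {set {set {set X}}} :=
  [set edge_split N (label N) e | e in cut_edges N].

Definition has_path (V : finType) (G : graph V) (u v : V) (n : nat) : bool :=
  [exists p : n.-tuple V,
    [&& path (adj G) u p, uniq (u :: p) & last u p == v]].

Lemma has_path_ex (X : finType) (N : network X) (u v : vertex N) :
  exists n, has_path N u v n.
Proof.
have /andP[_ /forall_inP/(_ u)] := net_connected N.
rewrite net_verts inE => /(_ isT) /forall_inP/(_ v); rewrite inE => /(_ isT).
case/connectP=> p pth ->; case/shortenP: pth => q pq uq _.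
by exists (size q); apply/existsP; exists (in_tuple q); rewrite pq uq eqxx.
Qed.

Definition dm (X : finType) (N : network X) (x y : X) : nat :=
  ex_minn (has_path_ex (label N x) (label N y)).

Definition dist_matrix (X : finType) (N : network X) : {ffun X * X -> nat} :=
  [ffun p => dm N p.1 p.2].

Definition is_split (X : finType) (A B : {set X}) : Prop :=
  [/\ A != set0, B != set0, A :|: B = setT & [disjoint A & B]].

(* Main.v *)
(** Distances across a cut edge add up, which gives necessity. Conversely, the
two conditions forbid a cut edge both of whose sides meet both [A] and [B], so
if [A|B] is not induced, every cut edge has exactly one two-coloured side. At a
smallest such side sits a class [C] of vertices joined by noncut edges all of
whose pendant parts are monochromatic, at least two of each colour; [C] spans a
blob, and the conditions on leaves become conditions on the attachment vertices.

By the level hypothesis at most two vertices of the blob carry no pendant part.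
No theta-graph structure is needed beyond this: writing [e(S)] for the number
of blob edges leaving [S], bridgelessness gives [e(S) >= 2], and [e(S)] has the
parity of the number of degree-three vertices in [S]. Two disjoint edges from
colour [A] to colour [B], or one such edge and a disjoint length-two link,
violate condition (ii); counting edges between the colour classes and the
degree-three vertices leaves only the case where condition (i), or a
vertex of too large degree, yields the contradiction. *)

Require Import Defs.
From mathcomp Require Import all_boot.
From mathcomp Require Import zify.

Set Implicit Arguments.
Unset Strict Implicit.
Unset Printing Implicit Defensive.

(** * Weighted edge counts *)

Definition edge_weight (V : finType) (h : rel V) (f g : V -> nat) : nat :=
  \sum_x \sum_y f x * g y * h x y.

Definition addf (V : finType) (f g : V -> nat) (x : V) : nat := f x + g x.
Definition ind (V : finType) (S : {set V}) (x : V) : nat := (x \in S).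
Definition ind1 (V : finType) (x y : V) : nat := (y == x).

Section EdgeWeight.
Variables (V : finType) (h : rel V).
Implicit Types (f g : V -> nat) (S T : {set V}).
Local Notation ew := (edge_weight h).

Lemma edge_weightDl f f' g : ew (addf f f') g = ew f g + ew f' g.
Proof.
rewrite -big_split; apply: eq_bigr => x _; rewrite -big_split.
by apply: eq_bigr => y _; rewrite !mulnDl.
Qed.

Lemma edge_weightDr f g g' : ew f (addf g g') = ew f g + ew f g'.
Proof.
rewrite -big_split; apply: eq_bigr => x _; rewrite -big_split.
by apply: eq_bigr => y _; rewrite mulnDr mulnDl.
Qed.

Lemma eq_edge_weight f f' g g' : f =1 f' -> g =1 g' -> ew f g = ew f' g'.
Proof. by move=> ff gg; apply: eq_bigr => x _; apply: eq_bigr => y _; rewrite ff gg. Qed.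

Lemma edge_weight_gt0 f g :
  0 < ew f g -> exists x y, [/\ 0 < f x, 0 < g y & h x y].
Proof.
rewrite lt0n sum_nat_eq0 => /forallPn[x]; rewrite sum_nat_eq0.
case/forallPn=> y; rewrite -lt0n !muln_gt0 => /andP[/andP[fx gy]].
by case hxy: (h x y) => // _; exists x, y.
Qed.

Lemma edge_weight_ind1r f p : ew f (ind1 p) = \sum_x f x * h x p.
Proof.
apply: eq_bigr => x _; rewrite (bigD1 p) //= /ind1 eqxx muln1 big1 ?addn0 //.
by move=> y /negPf ->; rewrite muln0.
Qed.

Lemma edge_weight_ind1_ind1 x y : ew (ind1 x) (ind1 y) = h x y.
Proof.
rewrite edge_weight_ind1r (bigD1 x) //= /ind1 eqxx mul1n big1 ?addn0 //.
by move=> z /negPf ->.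
Qed.

Lemma edge_weight_ind_ind1 S p : ew (ind S) (ind1 p) = #|[set x in S | h x p]|.
Proof.
rewrite edge_weight_ind1r -sum1_card [RHS]big_mkcond; apply: eq_bigr => x _.
by rewrite !inE /ind; case: (x \in S); case: (h x p).
Qed.

Lemma ind_gt0 S : 0 < #|S| -> exists x, 0 < ind S x.
Proof. by case/card_gt0P=> x xS; exists x; rewrite /ind xS. Qed.

Lemma ind_setD1 S x : x \in S -> ind S =1 addf (ind1 x) (ind (S :\ x)).
Proof.
move=> xS y; rewrite /ind /addf /ind1 !inE.
by case: eqP => [->|]; rewrite ?xS.
Qed.

Lemma edge_weight_eq0 f g : (forall x y, 0 < f x -> 0 < g y -> h x y -> False) ->
  ew f g = 0.
Proof.
move=> no; case: (posnP (ew f g)) => // /edge_weight_gt0[x [y [fx gy hxy]]].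
by case: (no x y).
Qed.

Lemma edge_weight_suml f g : ew f g = \sum_x f x * ew (ind1 x) g.
Proof.
apply: eq_bigr => x _; rewrite /edge_weight [in RHS](bigD1 x) //=.
rewrite [X in _ + X]big1 ?addn0.
  by rewrite big_distrr /=; apply: eq_bigr => y _; rewrite /ind1 eqxx mul1n mulnA.
by move=> z /negPf zx; rewrite big1 // => y _; rewrite /ind1 zx.
Qed.

Lemma edge_weight_ge2 f g s t u v :
  h s t -> h u v -> 0 < f s -> 0 < f u -> 0 < g t -> 0 < g v ->
  (s, t) != (u, v) -> 2 <= ew f g.
Proof.
move=> hst huv fs fu gt gv ne; rewrite /edge_weight pair_big /=.
rewrite (bigD1 (s, t)) //= (bigD1 (u, v)) /=; last by rewrite eq_sym.
rewrite hst huv !muln1 addnA; apply: leq_trans (leq_addr _ _).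
by rewrite (@leq_add 1 1) ?muln_gt0 ?fs ?fu.
Qed.

Hypothesis hC : symmetric h.

Lemma edge_weightC f g : ew f g = ew g f.
Proof.
rewrite /edge_weight exchange_big; apply: eq_bigr => x _; apply: eq_bigr => y _.
by rewrite hC [f y * _]mulnC.
Qed.

Hypothesis h_irr : irreflexive h.

Lemma edge_weight_even f : exists k, ew f f = 2 * k.
Proof.
suff /(_ #|V|) gen : forall n, forall F : V -> nat,
    #|[set x | F x != 0]| <= n -> exists k, ew F F = 2 * k.
  by apply: gen; apply: max_card.
elim=> [|n IH] F.
  rewrite leqn0 cards_eq0 => /eqP F0; exists 0.
  rewrite /edge_weight big1 // => x _; rewrite big1 // => y _.
  by have := in_set0 x; rewrite -F0 inE => /negbFE/eqP ->.
case: (posnP #|[set x | F x != 0]|) => [F0 _|]; first by apply: IH; rewrite F0.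
case/card_gt0P=> x xF cF.
pose F1 y := if y == x then F x else 0.
pose F2 y := if y == x then 0 else F y.
have FE : F =1 addf F1 F2.
  by move=> y; rewrite /addf /F1 /F2; case: eqP => [->|]; rewrite ?addn0.
have [k Ek] : exists k, ew F2 F2 = 2 * k.
  apply: IH; move: cF; rewrite (cardsD1 x) xF add1n ltnS; apply: leq_trans.
  apply: subset_leq_card; apply/subsetP => y; rewrite !inE /F2.
  by case: (y == x).
have E1 : ew F1 F1 = 0.
  rewrite /edge_weight big1 // => y _; rewrite big1 // => z _; rewrite /F1.
  by case: eqP => // ->; case: eqP => [->|]; rewrite ?h_irr !muln0.
exists (ew F1 F2 + k); rewrite (eq_edge_weight FE FE) edge_weightDl !edge_weightDr.
by rewrite (edge_weightC F2 F1); lia.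
Qed.

End EdgeWeight.

(** * Two-coloured blobs with at most two branching vertices *)

(* [P] collects the vertices of the blob with three neighbours inside it; the
   others carry a pendant part of the network, coloured by [A] or [B]. *)
Record bicolored_blob (V : finType) (h : rel V) (d : V -> V -> nat)
    (A B P : {set V}) : Prop := BicoloredBlob {
  bb_sym : symmetric h;
  bb_irr : irreflexive h;
  bb_disj : forall x, ind A x + ind B x + ind P x <= 1;
  bb_deg : forall x, x \in A :|: B :|: P ->
    edge_weight h (ind1 x) (ind (A :|: B :|: P)) = 2 + ind P x;
  bb_cardP : #|P| <= 2;
  bb_cardA : 1 < #|A|;
  bb_cardB : 1 < #|B|;
  bb_cut : forall f g,
    (forall x, f x + g x = ind A x + ind B x + ind P x) ->
    (exists x, 0 < f x) -> (exists x, 0 < g x) -> 2 <= edge_weight h f g;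
  bb_dsym : forall x y, d x y = d y x;
  bb_d_gt0 : forall x y, x != y -> 0 < d x y;
  bb_d1 : forall x y, h x y -> d x y <= 1;
  bb_d2 : forall x z y, h x z -> h z y -> d x y <= 2;
  bb_d1_inv : forall x y, x \in A :|: B -> y \in A :|: B -> x != y ->
    d x y <= 1 -> h x y;
  bb_d2_inv : forall x y, x \in A :|: B -> y \in A :|: B -> x != y ->
    d x y <= 2 ->
    h x y \/ exists z, [/\ z \in A :|: B :|: P, h x z & h z y];
  bb_eq : forall a a' b b', a \in A -> a' \in A -> b \in B -> b' \in B ->
    a != a' -> b != b' -> d a b + d a' b' = d a b' + d a' b;
  bb_le : forall a a' b b', a \in A -> a' \in A -> b \in B -> b' \in B ->
    a != a' -> b != b' -> d a a' + d b b' + 2 <= d a b + d a' b'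
}.

Lemma bicolored_blob_sym (V : finType) (h : rel V) d (A B P : {set V}) :
  bicolored_blob h d A B P -> bicolored_blob h d B A P.
Proof.
move=> H; split; rewrite 1?[B :|: A]setUC; try by case: H.
- by move=> x; have := bb_disj H x; lia.
- by move=> f g fg; apply: (bb_cut H) => x; rewrite fg; lia.
- move=> a a' b b' aA a'A bB b'B aa bb; have := bb_eq H bB b'B aA a'A bb aa.
  by rewrite !(bb_dsym H a) !(bb_dsym H a'); lia.
- move=> a a' b b' aA a'A bB b'B aa bb; have := bb_le H bB b'B aA a'A bb aa.
  by rewrite !(bb_dsym H a b) !(bb_dsym H a'); lia.
Qed.

Section BicoloredBlob.
Variables (V : finType) (h : rel V) (d : V -> V -> nat) (A B P : {set V}).
Hypothesis H : bicolored_blob h d A B P.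
Local Notation ew := (edge_weight h).
Let C := A :|: B :|: P.

Lemma bb_indC : ind C =1 addf (addf (ind A) (ind B)) (ind P).
Proof.
move=> x; have := bb_disj H x; rewrite /addf /ind /C !inE.
by case: (x \in A); case: (x \in B); case: (x \in P).
Qed.

Lemma bb_evenC (S : {set V}) :
  S \subset A :|: B -> exists k, ew (ind S) (ind C) = 2 * k.
Proof.
move=> /subsetP sS; exists #|S|; rewrite edge_weight_suml mulnC -sum_nat_const.
rewrite [RHS]big_mkcond; apply: eq_bigr => x _; rewrite /ind.
case: ifP => // xS; have xAB := sS x xS; rewrite mul1n.
have xC : x \in C by rewrite /C inE xAB.
rewrite (bb_deg H xC); have := bb_disj H x; rewrite /ind; move: xAB; rewrite !inE.
by case: (x \in A); case: (x \in B); case: (x \in P).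
Qed.

Lemma bb_degP p : p \in P -> ew (ind1 p) (ind C) = 3.
Proof. by move=> pP; rewrite (bb_deg H) ?/ind ?pP // inE pP orbT. Qed.

Lemma bb_deg2 x : x \in A :|: B -> ew (ind1 x) (ind C) = 2.
Proof.
move=> xAB; have xC : x \in C by rewrite /C inE xAB.
rewrite (bb_deg H xC); have := bb_disj H x; rewrite /ind; move: xAB; rewrite !inE.
by case: (x \in A); case: (x \in B); case: (x \in P).
Qed.

Lemma bb_P : P = set0 \/ exists p q, [/\ p \in P, q \in P &
  ind P =1 addf (ind1 p) (ind1 q)].
Proof.
case cP: #|P| (bb_cardP H) => [|[|[|n]]] // _.
- by left; apply/eqP; rewrite -cards_eq0 cP.
- have /cards1P[p EP] : #|P| == 1 by rewrite cP.
  have pP : p \in P by rewrite EP inE.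
  have [k] := edge_weight_even (bb_sym H) (bb_irr H) (ind C).
  rewrite (eq_edge_weight _ bb_indC (fun=> erefl)) !edge_weightDl.
  have [kA ->] := bb_evenC (subsetUl A B).
  have [kB ->] := bb_evenC (subsetUr A B).
  rewrite (_ : ew (ind P) (ind C) = 3); first by lia.
  rewrite -(bb_degP pP); apply: eq_edge_weight => // x.
  by rewrite /ind /ind1 EP inE.
- have /cards2P[p [q [pq EP]]] : #|P| == 2 by rewrite cP.
  right; exists p, q; rewrite EP !inE !eqxx orbT; split=> // x.
  rewrite /ind /ind1 /addf !inE.
  by case: eqP => [->|_]; rewrite ?(negPf pq).
Qed.

Lemma bb_edges a a' b b' : a \in A -> a' \in A -> b \in B -> b' \in B ->
  a != a' -> b != b' -> h a b -> h a' b' -> False.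
Proof.
move=> aA a'A bB b'B aa bb hab hab'.
have := bb_le H aA a'A bB b'B aa bb.
have := bb_d1 H hab; have := bb_d1 H hab'.
have := bb_d_gt0 H aa; have := bb_d_gt0 H bb; clear; lia.
Qed.

Lemma bb_edge_link a a' b b' p : a \in A -> a' \in A -> b \in B -> b' \in B ->
  a != a' -> b != b' -> h a b -> h a' p -> h p b' -> False.
Proof.
move=> aA a'A bB b'B aa bb hab hap hpb.
have := bb_le H aA a'A bB b'B aa bb.
have := bb_d1 H hab; have := bb_d2 H hap hpb.
have := bb_d_gt0 H aa; have := bb_d_gt0 H bb; clear; lia.
Qed.

Lemma bb_link0 f g p :
  (forall x y, 0 < f x -> 0 < g y -> h x p -> h p y -> False) ->
  ew f (ind1 p) = 0 \/ ew g (ind1 p) = 0.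
Proof.
move=> no; case: (posnP (ew f (ind1 p))) => [|/edge_weight_gt0[x [z [fx zp hxz]]]].
  by left.
right; apply: edge_weight_eq0 => y z' gy z'p hyz; apply: (no x y) => //.
  by move: zp hxz; rewrite /ind1; case: eqP => // ->.
by move: z'p hyz; rewrite /ind1; case: eqP => // -> _; rewrite (bb_sym H).
Qed.

(* Split [A] and [B] at the edge [a b]: besides [a b], no edge and no length-two
   link may join the remainders [A'] and [B'], and the degree, parity and cut
   constraints on the resulting edge counts are then contradictory. *)
Lemma bb_edge_false a b : a \in A -> b \in B -> h a b -> False.
Proof.
move=> aA bB hab; set A' := A :\ a; set B' := B :\ b.
have EA := ind_setD1 aA; have EB := ind_setD1 bB.
have A'P x : 0 < ind A' x -> [/\ x \in A & a != x].
  by rewrite /ind !inE eq_sym; case: eqP => // _; case: (x \in A).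
have B'P x : 0 < ind B' x -> [/\ x \in B & b != x].
  by rewrite /ind !inE eq_sym; case: eqP => // _; case: (x \in B).
have A'0 : exists x, 0 < ind A' x.
  by apply: ind_gt0; have := bb_cardA H; rewrite (cardsD1 a) aA.
have B'0 : exists x, 0 < ind B' x.
  by apply: ind_gt0; have := bb_cardB H; rewrite (cardsD1 b) bB.
have wab : ew (ind1 a) (ind1 b) = 1 by rewrite edge_weight_ind1_ind1 hab.
have wA'B' : ew (ind A') (ind B') = 0.
  apply: edge_weight_eq0 => x y /A'P[xA ax] /B'P[yB bY] hxy.
  exact: (bb_edges aA xA bB yB).
have wA'B'p p : ew (ind A') (ind1 p) = 0 \/ ew (ind B') (ind1 p) = 0.
  apply: bb_link0 => x y /A'P[xA ax] /B'P[yB bY] hxp hpy.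
  exact: (bb_edge_link aA xA bB yB ax bY hab hxp hpy).
have wA'b : ew (ind A') (ind1 b) = 0 \/
    forall p, ew (ind1 a) (ind1 p) = 0 \/ ew (ind B') (ind1 p) = 0.
  case: (posnP (ew (ind A') (ind1 b))); first by left.
  case/edge_weight_gt0=> a2 [z [/A'P[a2A aa2] zb]].
  move: zb; rewrite /ind1; case: eqP => // -> _ ha2b; right=> p.
  apply: bb_link0 => x y xa /B'P[yB bY] hxp hpy.
  move: xa hxp; rewrite /ind1; case: eqP => // -> _ hap.
  by apply: (bb_edge_link a2A aA bB yB) ha2b hap hpy => //; rewrite eq_sym.
have waB' : ew (ind1 a) (ind B') = 0 \/
    forall p, ew (ind A') (ind1 p) = 0 \/ ew (ind1 b) (ind1 p) = 0.
  case: (posnP (ew (ind1 a) (ind B'))); first by left.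
  case/edge_weight_gt0=> z [b2 [za /B'P[b2B bb2]]].
  move: za; rewrite /ind1; case: eqP => // -> _ hab2; right=> p.
  apply: bb_link0 => x y /A'P[xA ax] yb hxp hpy.
  move: yb hpy; rewrite /ind1; case: eqP => // -> _ hpb.
  by apply: (bb_edge_link aA xA b2B bB) hab2 hxp hpb => //; rewrite eq_sym.
have wx : ew (ind A') (ind1 b) = 0 \/ ew (ind1 a) (ind B') = 0.
  case: (posnP (ew (ind A') (ind1 b))) => [|/edge_weight_gt0[x [z [/A'P[xA ax]]]]].
    by left.
  rewrite /ind1; case: eqP => // -> _ hxb; right.
  apply: edge_weight_eq0 => z1 y; case: eqP => // -> _ /B'P[yB bY] hay.
  by apply: (bb_edges aA xA yB bB) => //; rewrite eq_sym.
have symw := edge_weightC (bb_sym H).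
have irr x : ew (ind1 x) (ind1 x) = 0.
  by rewrite edge_weight_ind1_ind1 (bb_irr H).
have [kA' EkA'] := edge_weight_even (bb_sym H) (bb_irr H) (ind A').
have [kB' EkB'] := edge_weight_even (bb_sym H) (bb_irr H) (ind B').
have sA' : A' \subset A :|: B by apply: subset_trans (subsetUl _ _); apply: subsetDl.
have sB' : B' \subset A :|: B by apply: subset_trans (subsetUr _ _); apply: subsetDl.
have [lA' dA'] := bb_evenC sA'; have [lB' dB'] := bb_evenC sB'.
have da : ew (ind1 a) (ind C) = 2 by apply: bb_deg2; rewrite inE aA.
have db : ew (ind1 b) (ind C) = 2 by apply: bb_deg2; rewrite inE bB orbT.
have cut f g : addf f g =1 ind C -> (exists x, 0 < f x) -> (exists x, 0 < g x) ->
    2 <= ew f g.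
  by move=> fg; apply: (bb_cut H) => x; rewrite -[LHS]/(addf f g x) fg bb_indC.
have [P0|[p [q [pP qP EP]]]] := bb_P.
  have EC : ind C =1 addf (addf (ind1 a) (ind A')) (addf (ind1 b) (ind B')).
    move=> x; rewrite bb_indC /addf EA EB /addf (_ : ind P x = 0) ?addn0 //.
    by rewrite /ind P0 inE.
  have : 2 <= ew (ind A') (addf (ind1 a) (addf (ind1 b) (ind B'))).
    apply: cut => //; first by move=> x; rewrite EC /addf; clear; lia.
    by exists a; rewrite /addf /ind1 eqxx.
  have : 2 <= ew (ind B') (addf (ind1 b) (addf (ind1 a) (ind A'))).
    apply: cut => //; first by move=> x; rewrite EC /addf; clear; lia.
    by exists b; rewrite /addf /ind1 eqxx.
  move: dA' dB' da db; rewrite !(eq_edge_weight _ (fun=> erefl) EC) !edge_weightDr.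
  rewrite !(symw (ind B')) !(symw (ind A') (ind1 _)) !(symw (ind1 b) (ind1 a)).
  have := symw (ind1 b) (ind A'); have := symw (ind1 b) (ind B').
  have := symw (ind1 a) (ind A').
  have ia := irr a; have ib := irr b.
  clear -wx wab wA'B' EkA' EkB' ia ib.
  lia.
have EC : ind C =1 addf (addf (addf (ind1 a) (ind A')) (addf (ind1 b) (ind B')))
    (addf (ind1 p) (ind1 q)).
  by move=> x; rewrite bb_indC /addf EA EB EP.
have exa : exists x, 0 < ind1 a x by exists a; rewrite /ind1 eqxx.
have exl f g : (exists x, 0 < f x) -> exists x, 0 < addf f g x.
  by case=> x fx; exists x; rewrite /addf ltn_addr.
have exr f g : (exists x, 0 < g x) -> exists x, 0 < addf f g x.
  by case=> x gx; exists x; rewrite /addf ltn_addl.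
have dp := bb_degP pP; have dq := bb_degP qP.
have cA : 2 <= ew (ind A') (addf (addf (ind B') (addf (ind1 a) (ind1 b)))
                                 (addf (ind1 p) (ind1 q))).
  by apply: cut; [move=> x; rewrite EC /addf; clear; lia | | apply/exl/exl].
have cB : 2 <= ew (ind B') (addf (addf (ind A') (addf (ind1 a) (ind1 b)))
                                 (addf (ind1 p) (ind1 q))).
  by apply: cut; [move=> x; rewrite EC /addf; clear; lia | | apply/exl/exl].
have cAp : 2 <= ew (addf (ind A') (ind1 p))
                   (addf (addf (ind B') (addf (ind1 a) (ind1 b))) (ind1 q)).
  by apply: cut; [move=> x; rewrite EC /addf; clear; lia | apply/exl | apply/exl/exl].
have cAq : 2 <= ew (addf (ind A') (ind1 q))
                   (addf (addf (ind B') (addf (ind1 a) (ind1 b))) (ind1 p)).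
  by apply: cut; [move=> x; rewrite EC /addf; clear; lia | apply/exl | apply/exl/exl].
have cBp : 2 <= ew (addf (ind B') (ind1 p))
                   (addf (addf (ind A') (addf (ind1 a) (ind1 b))) (ind1 q)).
  by apply: cut; [move=> x; rewrite EC /addf; clear; lia | apply/exl | apply/exl/exl].
have cBq : 2 <= ew (addf (ind B') (ind1 q))
                   (addf (addf (ind A') (addf (ind1 a) (ind1 b))) (ind1 p)).
  by apply: cut; [move=> x; rewrite EC /addf; clear; lia | apply/exl | apply/exl/exl].
have cApq : 2 <= ew (addf (ind A') (addf (ind1 p) (ind1 q)))
                   (addf (ind B') (addf (ind1 a) (ind1 b))).
  by apply: cut; [move=> x; rewrite EC /addf; clear; lia | apply/exl | apply/exl].
have cBpq : 2 <= ew (addf (ind B') (addf (ind1 p) (ind1 q)))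
                   (addf (ind A') (addf (ind1 a) (ind1 b))).
  by apply: cut; [move=> x; rewrite EC /addf; clear; lia | apply/exl | apply/exl].
have [ia ib] := (irr a, irr b); have [ip iq] := (irr p, irr q).
have sab := symw (ind1 b) (ind1 a).
have saA := symw (ind A') (ind1 a); have saB := symw (ind B') (ind1 a).
have sbA := symw (ind A') (ind1 b); have sbB := symw (ind B') (ind1 b).
have sAB := symw (ind B') (ind A').
have spA := symw (ind1 p) (ind A'); have spB := symw (ind1 p) (ind B').
have spa := symw (ind1 p) (ind1 a); have spb := symw (ind1 p) (ind1 b).
have sqA := symw (ind1 q) (ind A'); have sqB := symw (ind1 q) (ind B').
have sqa := symw (ind1 q) (ind1 a); have sqb := symw (ind1 q) (ind1 b).
have spq := symw (ind1 q) (ind1 p).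
have [wp wq] := (wA'B'p p, wA'B'p q).
have {wA'b} wb : ew (ind A') (ind1 b) = 0 \/
    (ew (ind1 a) (ind1 p) = 0 \/ ew (ind B') (ind1 p) = 0) /\
    (ew (ind1 a) (ind1 q) = 0 \/ ew (ind B') (ind1 q) = 0).
  by case: wA'b => [|w]; [left | right].
have {waB'} wa : ew (ind1 a) (ind B') = 0 \/
    (ew (ind A') (ind1 p) = 0 \/ ew (ind1 b) (ind1 p) = 0) /\
    (ew (ind A') (ind1 q) = 0 \/ ew (ind1 b) (ind1 q) = 0).
  by case: waB' => [|w]; [left | right].
move: dA' dB' da db dp dq cA cB cAp cAq cBp cBq cApq cBpq.
rewrite !(eq_edge_weight _ (fun=> erefl) EC) !edge_weightDl !edge_weightDr.
rewrite sab saA saB sbA sbB sAB spA spB spa spb sqA sqB sqa sqb spq.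
rewrite sbA in wb wx.
rewrite ia ib ip iq wab wA'B' EkA' EkB'.
have : ew (ind1 p) (ind1 q) <= 1 by rewrite edge_weight_ind1_ind1 leq_b1.
move: wp wq wb wa wx; clear.
lia.
Qed.

Lemma bb_three_neighbors x y1 y2 y3 : x \in A :|: B ->
  y1 \in C -> y2 \in C -> y3 \in C -> uniq [:: y1; y2; y3] ->
  h x y1 -> h x y2 -> h x y3 -> False.
Proof.
move=> xAB y1C y2C y3C u h1 h2 h3; have := bb_deg2 xAB.
rewrite (edge_weightC (bb_sym H)) edge_weight_ind_ind1 => c2.
suff : size [:: y1; y2; y3] <= 2 by [].
rewrite -c2 cardE; apply: uniq_leq_size => // z; rewrite !inE mem_enum !inE.
have inC y : y \in C -> h x y -> ((y \in A) || (y \in B) || (y \in P)) && h y x.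
  by rewrite /C !inE (bb_sym H y) => -> ->.
by case/or3P=> /eqP ->; apply: inC.
Qed.

Section TwoBranchings.
Variables p q : V.
Hypotheses (pP : p \in P) (qP : q \in P).
Hypothesis EP : ind P =1 addf (ind1 p) (ind1 q).
Hypothesis noAB : forall a b, a \in A -> b \in B -> ~ h a b.

Lemma bb_in_pq z : z \in P -> z = p \/ z = q.
Proof.
move=> zP; have := EP z; rewrite /ind /addf /ind1 zP.
by case: eqP => [->|_]; [left | case: eqP => [->|_] //; right].
Qed.

Lemma bb_no_shortcut x : x \in A ->
  ew (ind A) (ind1 p) = 1 -> ew (ind A) (ind1 q) = 1 ->
  h x p -> h x q -> False.
Proof.
move=> xA Ap Aq hxp hxq; set A' := A :\ x.
have EA : ind A =1 addf (ind1 x) (ind A') := ind_setD1 xA.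
have wAB : ew (ind A) (ind B) = 0.
  apply: edge_weight_eq0 => a b; rewrite /ind => aA bB; apply: noAB; first by case: (a \in A) aA.
  by case: (b \in B) bB.
have EC : ind C =1 addf (addf (addf (ind1 x) (ind A')) (ind B)) (addf (ind1 p) (ind1 q)).
  by move=> y; rewrite bb_indC /addf EA EP.
have : 2 <= ew (ind A') (addf (addf (ind1 x) (ind B)) (addf (ind1 p) (ind1 q))).
  apply: (bb_cut H).
  - by move=> y; rewrite EA EP /addf -/A'; clear; lia.
  - by apply: ind_gt0; have := bb_cardA H; rewrite (cardsD1 x) xA.
  - by exists x; rewrite /addf /ind1 eqxx.
have dx : ew (ind1 x) (ind C) = 2 by apply: bb_deg2; rewrite inE xA.
move: Ap Aq wAB dx; rewrite (eq_edge_weight _ (fun=> erefl) EC).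
rewrite !(eq_edge_weight _ EA (fun=> erefl)) !edge_weightDr !edge_weightDl.
rewrite !edge_weight_ind1_ind1 hxp hxq (bb_irr H).
by rewrite (edge_weightC (bb_sym H) (ind A') (ind1 x)); clear; lia.
Qed.

End TwoBranchings.

End BicoloredBlob.

Section NoCrossEdge.
Variables (V : finType) (h : rel V) (d : V -> V -> nat) (A B P : {set V}).
Hypothesis H : bicolored_blob h d A B P.
Variables p q : V.
Hypotheses (pP : p \in P) (qP : q \in P).
Hypothesis EP : ind P =1 addf (ind1 p) (ind1 q).
Hypothesis noAB : forall a b, a \in A -> b \in B -> ~ h a b.
Local Notation ew := (edge_weight h).

Lemma bb_single_link_false :
  ew (ind A) (ind1 p) = 1 -> ew (ind A) (ind1 q) = 1 ->
  ew (ind B) (ind1 p) = ew (ind B) (ind1 q) ->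
  0 < ew (ind B) (ind1 p) <= 2 -> False.
Proof.
move=> Ap Aq Bpq B12; have hC := bb_sym H.
have AB x : x \in A -> x \in A :|: B by rewrite inE => ->.
have BB x : x \in B -> x \in A :|: B by rewrite inE => ->; rewrite orbT.
have noBA b a : b \in B -> a \in A -> ~ h b a by rewrite hC => bB aA; apply: noAB.
have disj x : x \in P -> x \notin A :|: B.
  by have := bb_disj H x; rewrite /ind !inE; do 3 case: (x \in _).
move: (Ap) (Aq); rewrite !edge_weight_ind_ind1.
move=> /eqP/cards1P[a EAp] /eqP/cards1P[a' EAq].
have /setIdP[aA hap] : a \in [set x in A | h x p] by rewrite EAp inE.
have /setIdP[a'A haq] : a' \in [set x in A | h x q] by rewrite EAq inE.
have aa' : a != a'.
  apply/eqP => aa'; rewrite -aa' in haq.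
  exact: (bb_no_shortcut H EP noAB aA Ap Aq hap haq).
have link b b' : b \in B -> b' \in B -> b != b' -> h b p -> h b' q ->
    h b b' /\ (d a b' <= 2 \/ d a' b <= 2).
  move=> bB b'B bb' hbp hbq; rewrite hC in hbp; rewrite hC in hbq.
  have := bb_le H aA a'A bB b'B aa' bb'; have := bb_eq H aA a'A bB b'B aa' bb'.
  have := bb_d2 H hap hbp; have := bb_d2 H haq hbq.
  have := bb_d_gt0 H aa'; have := bb_d_gt0 H bb' => d1 d2 d3 d4 d5 d6; split.
    apply: (bb_d1_inv H) => //; [exact: BB | exact: BB | ].
    by move: d1 d2 d3 d4 d5 d6; clear; lia.
  by move: d1 d2 d3 d4 d5 d6; clear; lia.
have [B2|B1] : ew (ind B) (ind1 q) = 2 \/ ew (ind B) (ind1 q) = 1.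
  by move: B12; rewrite Bpq; clear; lia.
  move: (B2) (Bpq); rewrite !edge_weight_ind_ind1.
  move=> /eqP/cards2P[b3 [b4 [b34 EBq]]].
  rewrite {1}EBq cards2 b34 => /eqP/cards2P[b1 [b2 [b12 EBp]]].
  have /setIdP[b1B hb1] : b1 \in [set x in B | h x p] by rewrite EBp !inE eqxx.
  have /setIdP[b3B hb3] : b3 \in [set x in B | h x q] by rewrite EBq !inE eqxx.
  have /setIdP[b4B hb4] : b4 \in [set x in B | h x q] by rewrite EBq !inE eqxx orbT.
  have neP x z : x \in B -> z \in P -> x != z.
    by move=> xB zP; apply: contraNneq (disj z zP) => <-; apply: BB.
  have inC x : x \in B -> x \in A :|: B :|: P by move=> xB; rewrite inE BB.
  have PC x : x \in P -> x \in A :|: B :|: P by move=> xP; rewrite inE xP orbT.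
  have pq : p != q.
    by apply/eqP => pq; move/eqP: (EP p); rewrite /ind /addf /ind1 pP pq eqxx.
  have final y : y \in B -> y != b1 -> h b1 q -> h y q -> False.
    move=> yB yb1 hb1q hyq; have [] := link b1 y b1B yB _ hb1 hyq; first by rewrite eq_sym.
    move=> hb1y _; apply: (bb_three_neighbors H (BB _ b1B) (PC _ pP) (PC _ qP) (inC _ yB)) => //.
    by rewrite /= !inE negb_or pq !(eq_sym _ y) !neP.
  have [E|n13] := eqVneq b1 b3.
    by subst b3; apply: (final b4) => //; rewrite eq_sym.
  have [E|n14] := eqVneq b1 b4.
    by subst b4; apply: (final b3) => //.
  have [h13 _] := link b1 b3 b1B b3B n13 hb1 hb3.
  have [h14 _] := link b1 b4 b1B b4B n14 hb1 hb4.
  apply: (bb_three_neighbors H (BB _ b1B) (inC _ b3B) (inC _ b4B) (PC _ pP)) => //.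
  by rewrite /= !inE negb_or b34 !neP.
move: (B1) (Bpq); rewrite !edge_weight_ind_ind1 => /eqP/cards1P[b' EBq].
rewrite {1}EBq cards1 => /eqP/cards1P[b EBp].
have /setIdP[bB hbp] : b \in [set x in B | h x p] by rewrite EBp inE.
have /setIdP[b'B hbq] : b' \in [set x in B | h x q] by rewrite EBq inE.
have bb' : b != b'.
  apply/eqP => bb'; rewrite -bb' in hbq.
  apply: (bb_no_shortcut (bicolored_blob_sym H) EP _ bB _ B1 hbp hbq) => //.
  by rewrite Bpq.
have neAB x y : x \in A -> y \in B -> x != y.
  by move=> xA yB; apply/eqP => xy; have := bb_disj H x; rewrite /ind xA xy yB.
have noway x y : x \in A -> y \in B -> d x y <= 2 ->
    (h x p -> h y p -> False) -> (h x q -> h y q -> False) -> False.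
  move=> xA yB dxy nop noq.
  have [|[z [zC hxz hzy]]] := bb_d2_inv H (AB _ xA) (BB _ yB) (neAB _ _ xA yB) dxy.
    exact: noAB.
  move: zC; rewrite !inE -orbA => /or3P[zA|zB|zP].
  - by apply: (noAB zA yB).
  - by apply: (noAB xA zB).
  - case: (bb_in_pq EP zP) => Ez; subst z; rewrite hC in hzy; [exact: nop|exact: noq].
have [_ [dab'|da'b]] := link b b' bB b'B bb' hbp hbq.
  apply: (noway a b' aA b'B dab') => [_ hb'p|haq' _].
    have : b' \in [set x in B | h x p] by rewrite !inE b'B.
    by rewrite EBp inE eq_sym (negPf bb').
  have : a \in [set x in A | h x q] by rewrite !inE aA.
  by rewrite EAq inE (negPf aa').
apply: (noway a' b a'A bB da'b) => [ha'p _|_ hb'q].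
  have : a' \in [set x in A | h x p] by rewrite !inE a'A.
  by rewrite EAp inE eq_sym (negPf aa').
have : b \in [set x in B | h x q] by rewrite !inE bB.
by rewrite EBq inE (negPf bb').
Qed.

End NoCrossEdge.

Theorem bicolored_blob_false (V : finType) (h : rel V) d (A B P : {set V}) :
  ~ bicolored_blob h d A B P.
Proof.
move=> H; have noAB a b : a \in A -> b \in B -> ~ h a b.
  by move=> aA bB; apply: (bb_edge_false H aA bB).
have wAB : edge_weight h (ind A) (ind B) = 0.
  apply: edge_weight_eq0 => a b; rewrite /ind => aA bB; apply: noAB; first by case: (a \in A) aA.
  by case: (b \in B) bB.
have exA := ind_gt0 (ltnW (bb_cardA H)); have exB := ind_gt0 (ltnW (bb_cardB H)).
have [P0|[p [q [pP qP EP]]]] := bb_P H.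
  have : 2 <= edge_weight h (ind A) (ind B); last by rewrite wAB.
  by apply: (bb_cut H) => // x; rewrite /ind P0 inE addn0.
have exl f g : (exists x, 0 < f x) -> exists x : V, 0 < addf f g x.
  by case=> x fx; exists x; rewrite /addf ltn_addr.
have EC := bb_indC H.
have [kA EkA] := edge_weight_even (bb_sym H) (bb_irr H) (ind A).
have [kB EkB] := edge_weight_even (bb_sym H) (bb_irr H) (ind B).
have [lA dA] := bb_evenC H (subsetUl A B); have [lB dB] := bb_evenC H (subsetUr A B).
have dp := bb_degP H pP; have dq := bb_degP H qP.
have cA : 2 <= edge_weight h (ind A) (addf (ind B) (addf (ind1 p) (ind1 q))).
  by apply: (bb_cut H); [move=> x; rewrite EP /addf; clear; lia | | apply/exl].
have cB : 2 <= edge_weight h (ind B) (addf (ind A) (addf (ind1 p) (ind1 q))).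
  by apply: (bb_cut H); [move=> x; rewrite EP /addf; clear; lia | | apply/exl].
have cAp : 2 <= edge_weight h (addf (ind A) (ind1 p)) (addf (ind B) (ind1 q)).
  by apply: (bb_cut H); [move=> x; rewrite EP /addf; clear; lia | apply/exl | apply/exl].
have cAq : 2 <= edge_weight h (addf (ind A) (ind1 q)) (addf (ind B) (ind1 p)).
  by apply: (bb_cut H); [move=> x; rewrite EP /addf; clear; lia | apply/exl | apply/exl].
have symw := edge_weightC (bb_sym H).
have irr x : edge_weight h (ind1 x) (ind1 x) = 0.
  by rewrite edge_weight_ind1_ind1 (bb_irr H).
have wpq : edge_weight h (ind1 p) (ind1 q) <= 1 by rewrite edge_weight_ind1_ind1 leq_b1.
move: dA dB dp dq cA cB cAp cAq.
rewrite !(eq_edge_weight _ (fun=> erefl) EC) !edge_weightDr !edge_weightDl.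
rewrite !(eq_edge_weight _ (fun=> erefl) EP) !edge_weightDr.
rewrite !irr EkA EkB (symw (ind B) (ind A)) wAB.
rewrite !(symw (ind1 p) (ind _)) !(symw (ind1 q) (ind _)) (symw (ind1 q) (ind1 p)).
move=> dA dB dp dq cA cB cAp cAq.
have [Ap Bp] : edge_weight h (ind A) (ind1 p) = edge_weight h (ind A) (ind1 q) /\
  edge_weight h (ind B) (ind1 p) = edge_weight h (ind B) (ind1 q) by lia.
have [A1|A2] : edge_weight h (ind A) (ind1 p) = 1 \/
  edge_weight h (ind A) (ind1 p) = 2 by lia.
- by apply: (bb_single_link_false H pP qP EP noAB); rewrite -?Ap //; lia.
- apply: (bb_single_link_false (bicolored_blob_sym H) pP qP EP) => //; try lia.
  by move=> b a bB aA; rewrite (bb_sym H); apply: noAB.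
Qed.

(** * Simple graphs *)

Section Graphs.
Variable V : finType.
Implicit Types (G : graph V) (u v w x y z : V) (e : {set V}).

Lemma adj_sym G : symmetric (adj G).
Proof. by move=> x y; rewrite /adj /= setUC. Qed.

Lemma connect_adj_sym G : connect_sym (adj G).
Proof. exact: sym_connect_sym (adj_sym G). Qed.

Lemma adj_irr G : is_simple G -> irreflexive (adj G).
Proof.
move=> sG x; apply/negbTE/negP => /sG[_]; rewrite setUid cards1; done.
Qed.

Lemma edgeP G e : is_simple G -> e \in edges G ->
  exists x y, [/\ x != y, adj G x y & e = [set x; y]].
Proof.
move=> sG eG; have [_ /eqP/cards2P[x [y [xy E]]]] := sG _ eG.
by exists x, y; rewrite /adj /= -E.
Qed.

Lemma set2_inj x y z : [set x; y] = [set x; z] -> y = z.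
Proof.
move=> E; have : y \in [set x; z] by rewrite -E !inE eqxx orbT.
have : z \in [set x; y] by rewrite E !inE eqxx orbT.
by rewrite !inE => /orP[/eqP->|/eqP//] /orP[/eqP->|/eqP].
Qed.

Lemma set2_eqP x y u v : [set x; y] = [set u; v] ->
  x = u /\ y = v \/ x = v /\ y = u.
Proof.
move=> E; have : x \in [set u; v] by rewrite -E !inE eqxx.
rewrite !inE => /orP[]/eqP xE; subst x; [left | right]; split=> //.
  exact: set2_inj E.
by apply: (set2_inj (x := v)); rewrite E setUC.
Qed.

Lemma deg_neighbors G v : is_simple G -> deg G v = #|[set y | adj G v y]|.
Proof.
move=> sG; rewrite -(card_in_imset (f := fun y => [set v; y])); last first.
  by move=> y z _ _; apply: set2_inj.
apply: eq_card => e; rewrite inE; apply/andP/imsetP => [[eG ve]|[y]].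
  have [x [y [_ xy E]]] := edgeP sG eG; move: ve; rewrite E !inE.
  case/orP=> /eqP vE; subst v; first by exists y; rewrite ?inE.
  by exists x; rewrite ?inE 1?adj_sym // setUC.
by rewrite inE => vy ->; rewrite !inE eqxx.
Qed.

Lemma handshake G : is_simple G -> \sum_(v in verts G) deg G v = 2 * #|edges G|.
Proof.
move=> sG; under eq_bigr => v _ do rewrite /deg -sum1_card big_mkcond.
rewrite exchange_big mulnC -sum_nat_const [RHS]big_mkcond; apply: eq_bigr => e _ /=.
case: ifP => eG; last by rewrite big1 // => v _; rewrite inE eG.
have [/subsetP eV <-] := sG _ eG; rewrite -sum1_card -!big_mkcondr.
apply: eq_bigl => v; rewrite !inE eG /=.
by case ve: (v \in e); rewrite ?andbF // eV.
Qed.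

Lemma min_deg2_cycle (r : rel V) : symmetric r -> irreflexive r ->
  (exists x y, r x y) ->
  (forall x y, r x y -> exists2 z, z != y & r x z) ->
  exists2 c, 3 <= size c & ucycle r c.
Proof.
move=> rC r_irr [x0 [y0 r0]] deg2.
pose Q n := [exists x, exists p : n.-tuple V, path r x p && uniq (x :: p)].
have exQ : exists n, (0 < n) && Q n.
  exists 1; apply/existsP; exists x0; apply/existsP; exists [tuple y0].
  rewrite /= r0 inE !andbT; apply/eqP => E; by rewrite E r_irr in r0.
have ubQ n : (0 < n) && Q n -> n <= #|V|.
  case/andP=> _ /existsP[x /existsP[p /andP[_ /card_uniqP/= cp]]].
  by apply: leq_trans (max_card (mem (x :: p))); rewrite cp size_tuple.
case: (ex_maxnP exQ ubQ) => n /andP[n0 /existsP[x /existsP[p /andP[px ux]]]] maxn.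
case: p px ux => -[|y p] //= sp; first by rewrite -(eqP sp) in n0.
case/andP=> rxy py ux.
have [z zy rxz] := deg2 x y rxy.
have zx : z != x by apply/eqP => E; rewrite E r_irr in rxz.
have [zp|zp] := boolP (z \in y :: p); last first.
  have : n.+1 <= n; last by rewrite ltnn.
  apply: maxn; apply/existsP; exists z.
  have sq : size (x :: y :: p) == n.+1 by rewrite -(eqP sp).
  apply/existsP; exists (Tuple sq); rewrite /= rC rxz rxy py /=.
  by rewrite inE negb_or zx zp.
move: zp; rewrite inE (negPf zy) /= => zp.
case/splitPr: zp sp py ux => p1 p2 sp py ux.
exists (x :: y :: rcons p1 z); first by rewrite /= size_rcons.
rewrite /ucycle /= !rcons_path rxy last_rcons (rC z) rxz andbT.
move: py; rewrite cat_path /= => /and3P[-> -> _] /=.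
move: ux; rewrite -cat_rcons /= !inE !mem_cat !negb_or cat_uniq.
by case/and3P=> /and3P[-> -> _] /andP[-> _] /and3P[-> _ _].
Qed.

Lemma acyclic_card_edges G : is_simple G -> acyclic G -> verts G != set0 ->
  #|edges G| < #|verts G|.
Proof.
move=> sG acG V0; rewrite ltnNge; apply/negP => VE.
pose EW (W : {set V}) := [set e in edges G | e \subset W].
pose Q n := [exists W : {set V}, [&& #|W| == n, 0 < n & n <= #|EW W|]].
have exQ : exists n, Q n.
  exists #|verts G|; apply/existsP; exists (verts G); rewrite eqxx card_gt0 V0.
  rewrite (_ : EW _ = edges G) //; apply/setP => e; rewrite inE.
  by case eG: (e \in edges G) => //=; have [->] := sG e eG.
case: (ex_minnP exQ) => n /existsP[W /and3P[/eqP cW n0 nE]] minn.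
pose GW := Graph W (EW W).
have sGW : is_simple GW by move=> e; rewrite inE => /andP[/sG[_ ->] ->].
have adjG x y : adj GW x y -> adj G x y by rewrite /adj /= inE => /andP[].
have dW x : x \in W -> 2 <= deg GW x.
  move=> xW; rewrite ltnNge; apply/negP => dx.
  have EWx : #|EW W| <= deg GW x + #|EW (W :\ x)|.
    rewrite /deg -[leqRHS]cardsUI; apply: leq_trans (leq_addr _ _).
    apply/subset_leq_card/subsetP => e; rewrite !inE => /andP[-> eW] /=.
    rewrite eW /=; case xe: (x \in e) => //=; apply/subsetP => z ze.
    rewrite !inE (subsetP eW) // andbT; apply/eqP => E; by rewrite E xe in ze.
  have cWx : #|W :\ x| = n.-1 by rewrite -cW (cardsD1 x W) xW.
  have [n1|n1] : n = 1 \/ 1 < n by lia.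
    have : 0 < #|EW W| by lia.
    case/card_gt0P=> e; rewrite inE => /andP[/sG[_ ce] /subset_leq_card].
    by rewrite ce cW n1.
  have : n <= n.-1; last by lia.
  apply: minn; apply/existsP; exists (W :\ x); rewrite cWx eqxx.
  rewrite -ltnS prednK // n1 -ltnS prednK // (leq_trans nE) // (leq_trans EWx) //.
  by rewrite -add1n leq_add2r.
have [c c3 uc] : exists2 c, 3 <= size c & ucycle (adj GW) c.
  have nb2 x y : adj GW x y -> exists2 z, z != y & adj GW x z.
    move=> xy; have xW : x \in W.
      by move: xy; rewrite /adj /= inE => /andP[_ /subsetP]; apply; rewrite !inE eqxx.
    have := dW x xW; rewrite deg_neighbors // (cardsD1 y) inE xy ltnS.
    by case/card_gt0P=> z; rewrite !inE => /andP[zy xz]; exists z.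
  apply: min_deg2_cycle => //; [exact: adj_sym | exact: adj_irr |].
  have /card_gt0P[x xW] : 0 < #|W| by rewrite cW.
  have := ltnW (dW x xW); rewrite deg_neighbors // => /card_gt0P[y]; rewrite inE => xy.
  by exists x, y.
apply: (acG c c3); case/andP: uc => cc uc; apply/andP; split=> //.
by apply: sub_cycle cc => x y; apply: adjG.
Qed.

End Graphs.

(** * Distances and cut edges in a network *)

Lemma path_exit (T : Type) (r : rel T) (S : pred T) u (p : seq T) :
  path r u p -> S u -> ~~ S (last u p) ->
  exists p1 z p2, [/\ p = p1 ++ z :: p2, S (last u p1) & ~~ S z].
Proof.
elim: p u => [|z p IH] u /=; first by move=> _ ->.
case/andP=> _ pz Su lp; have [Sz|Sz] := boolP (S z).
  have [p1 [z' [p2 [-> S1 S2]]]] := IH z pz Sz lp.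
  by exists (z :: p1), z', p2.
by exists [::], z, p.
Qed.

Lemma path_relP (T : Type) (r s : rel T) u (p : seq T) : path r u p ->
  path s u p \/ exists p1 z p2,
    [/\ p = p1 ++ z :: p2, r (last u p1) z & ~~ s (last u p1) z].
Proof.
elim: p u => [|z p IH] u /=; first by left.
case/andP=> ruz pz; have [suz|suz] := boolP (s u z); last first.
  by right; exists [::], z, p.
have [sp|[p1 [z' [p2 [-> S1 S2]]]]] := IH z pz; first by left.
by right; exists (z :: p1), z', p2.
Qed.

Section Distance.
Variables (X : finType) (N : network X).
Implicit Types u v w x y z : vertex N.

Definition dist u v : nat := ex_minn (has_path_ex u v).

Lemma dist_path u v : exists p,
  [/\ path (adj N) u p, uniq (u :: p), last u p = v & size p = dist u v].
Proof.
rewrite /dist; case: ex_minnP => n /existsP[p /and3P[pp up /eqP lp]] _.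
by exists p; rewrite size_tuple.
Qed.

Lemma dist_le u p : path (adj N) u p -> dist u (last u p) <= size p.
Proof.
case/shortenP=> q pq uq sub; have /andP[_ uq'] := uq.
apply: leq_trans (uniq_leq_size uq' sub); rewrite /dist.
case: ex_minnP => n _; apply; apply/existsP; exists (in_tuple q).
by rewrite pq uq eqxx.
Qed.

Lemma dist_sym u v : dist u v = dist v u.
Proof.
suff le x y : dist x y <= dist y x by apply/eqP; rewrite eqn_leq !le.
have [p [pp _ lp <-]] := dist_path y x.
have := dist_le (u := x) (p := rev (belast y p)); rewrite size_rev size_belast.
have lr : last x (rev (belast y p)) = y.
  by case: p {pp} lp => [|z p] //= _; rewrite rev_cons last_rcons.
by rewrite lr; apply; rewrite -lp rev_path; apply: sub_path pp => a b; rewrite adj_sym.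
Qed.

Lemma dist_triangle v u w : dist u w <= dist u v + dist v w.
Proof.
have [p [pp _ lp <-]] := dist_path u v; have [q [pq _ lq <-]] := dist_path v w.
rewrite -size_cat -lq -lp -last_cat; apply: dist_le.
by rewrite cat_path pp lp.
Qed.

Lemma dist_gt0 u v : u != v -> 0 < dist u v.
Proof.
by have [[|z p] [_ _ /= lp <-]] := dist_path u v; rewrite // -lp eqxx.
Qed.

Lemma dist_adj u v : adj N u v -> dist u v <= 1.
Proof. by move=> uv; apply: (dist_le (p := [:: v])); rewrite /= uv. Qed.

Lemma dist1_inv u v : u != v -> dist u v <= 1 -> adj N u v.
Proof.
have [[|z [|z' p]] [/= pp _ <- <-]] := dist_path u v; rewrite ?eqxx //.
by rewrite andbT in pp.
Qed.

Lemma dist2_inv u v : u != v -> dist u v <= 2 ->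
  adj N u v \/ exists z, adj N u z /\ adj N z v.
Proof.
have [[|z [|z' [|z2 p]]] [/= pp _ <- <-]] := dist_path u v; rewrite ?eqxx //.
  by left; rewrite andbT in pp.
by right; exists z; case/and3P: pp.
Qed.

End Distance.

Section CutEdges.
Variables (X : finType) (N : network X).
Implicit Types u v w x y z : vertex N.

Definition without x y : rel (vertex N) := adj (del_edges N [set [set x; y]]).

Definition cut x y : bool := [set x; y] \in cut_edges N.

Definition far x y : {set vertex N} := [set w | connect (without x y) y w].

Lemma withoutE x y u v :
  without x y u v = adj N u v && ([set u; v] != [set x; y]).
Proof. by rewrite /without /adj /= !inE andbC. Qed.

Lemma without_sym x y : without x y = without y x.
Proof. by rewrite /without [[set x; y]]setUC. Qed.

Lemma connect_without_sym x y : connect_sym (without x y).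
Proof. exact: connect_adj_sym. Qed.

Lemma cut_sym x y : cut x y = cut y x.
Proof. by rewrite /cut setUC. Qed.

Lemma net_connect u v : connect (adj N) u v.
Proof.
have /andP[_ /forall_inP/(_ u)] := net_connected N.
by rewrite net_verts inE => /(_ isT)/forall_inP/(_ v); rewrite inE => /(_ isT).
Qed.

Lemma cutP x y : cut x y = adj N x y && ~~ connect (without x y) x y.
Proof.
rewrite /cut inE; case xy: ([set x; y] \in edges N); rewrite /adj /= xy //=.
congr (~~ _); apply/andP/idP => [[_ /forall_inP/(_ x)]|cxy].
  by rewrite net_verts inE => /(_ isT)/forall_inP/(_ y); rewrite inE; apply.
split; first by apply/set0Pn; exists x; rewrite net_verts inE.
apply/forall_inP => u _; apply/forall_inP => v _; move: (net_connect u v).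
apply: connect_sub => {u v} u v uv.
have [/set2_eqP[][-> ->]|ne] := eqVneq [set u; v] [set x; y].
- exact: cxy.
- by rewrite (connect_without_sym x y).
- by apply: connect1; rewrite -/(without x y u v) withoutE uv.
Qed.

Lemma cut_adj x y : cut x y -> adj N x y.
Proof. by rewrite cutP => /andP[]. Qed.

Lemma far_tip x y : y \in far x y.
Proof. by rewrite inE connect0. Qed.

Lemma far_base x y : cut x y -> x \notin far x y.
Proof. by rewrite cutP inE connect_without_sym => /andP[]. Qed.

Lemma far_compl x y : cut x y -> far y x = ~: far x y.
Proof.
move=> cxy; apply/setP => w; rewrite !inE (without_sym y x).
apply/idP/idP => [cxw|].
  apply/negP => cyw; have := far_base cxy; rewrite inE connect_without_sym.
  by rewrite (connect_trans cxw) // connect_without_sym.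
suff: connect (without x y) x w || connect (without x y) y w.
  by case/orP=> [//|->].
have /connectP[p px ->] := net_connect x w.
elim/last_ind: p px => [|p z IH]; first by rewrite /= connect0.
rewrite rcons_path last_rcons => /andP[/IH{}IH lz].
have [/set2_eqP[][_ ->]|ne] := eqVneq [set last x p; z] [set x; y].
- by rewrite connect0 orbT.
- by rewrite connect0.
have st : connect (without x y) (last x p) z by apply: connect1; rewrite withoutE lz.
by case/orP: IH => c; rewrite (connect_trans c st) ?orbT.
Qed.

Lemma far_cross x y u v : cut x y -> u \in far x y -> v \notin far x y ->
  adj N u v -> u = y /\ v = x.
Proof.
move=> cxy uF vF uv; have [/set2_eqP[][//]|ne] := eqVneq [set u; v] [set x; y].
  by move=> ux _; rewrite ux (negPf (far_base cxy)) in uF.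
case/negP: vF; move: uF; rewrite !inE => /connect_trans; apply.
by apply: connect1; rewrite withoutE uv.
Qed.

Lemma dist_cut x y u v : cut x y -> u \in far x y -> v \notin far x y ->
  dist u v = dist u y + 1 + dist x v.
Proof.
move=> cxy uF vF; have xy := cut_adj cxy.
apply/eqP; rewrite eqn_leq; apply/andP; split.
  have := dist_triangle y u v; have := dist_triangle x y v.
  have : dist y x <= 1 by apply: dist_adj; rewrite adj_sym.
  by move: (dist u v) => *; lia.
have [p [pp _ lp <-]] := dist_path u v.
have [|p1 [z [p2 [Ep S1 S2]]]] := path_exit pp uF; first by rewrite lp.
move: pp lp; rewrite Ep cat_path last_cat /= => /and3P[pp1 l1z pp2] lp.
have [Ey Ez] := far_cross cxy S1 S2 l1z; subst z.
have := dist_le pp1; have := dist_le pp2; rewrite Ey lp size_cat /=.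
by move: (dist x v) (dist u y); clear; lia.
Qed.

Definition noncut u v : bool := adj N u v && ~~ cut u v.

Lemma noncut_sym : symmetric noncut.
Proof. by move=> u v; rewrite /noncut adj_sym cut_sym. Qed.

Lemma noncut_irr : irreflexive noncut.
Proof. by move=> u; rewrite /noncut (adj_irr (@net_simple _ N)). Qed.

Lemma noncut_without x y u v : cut x y -> noncut u v -> without x y u v.
Proof.
move=> cxy /andP[uv nuv]; rewrite withoutE uv /=; apply: contraNneq nuv.
by rewrite /cut => ->.
Qed.

Lemma far_noncut x y u v : cut x y -> connect noncut u v ->
  (u \in far x y) = (v \in far x y).
Proof.
move=> cxy cuv; rewrite !inE; apply: same_connect_r; first exact: connect_without_sym.
by apply: connect_sub cuv => a b nab; apply: connect1; apply: noncut_without.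
Qed.

Lemma edge_splitE x y : cut x y -> edge_split N (label N) [set x; y] =
  [set label N @^-1: far x y; label N @^-1: far y x].
Proof.
move=> cxy.
have comp a b w : w \in far a b ->
    [set z | connect (without a b) w z] = far a b.
  rewrite inE => cbw; apply/setP => z; rewrite !inE.
  by apply: (same_connect (@connect_without_sym a b)); rewrite connect_without_sym.
have compE w : [set z | connect (without x y) w z] =
    if w \in far x y then far x y else far y x.
  case: ifP => wF; first exact: comp.
  by rewrite without_sym; apply: comp; rewrite far_compl // inE wF.
apply/setP => S; apply/imsetP/set2P => [[D /imsetP[w _ ->] ->]|].
  rewrite -/(without x y) compE; case: ifP => _; by [left | right].
case=> ->.
- exists (far x y) => //; apply/imsetP; exists y; rewrite ?net_verts ?inE //.
- exists (far y x) => //; apply/imsetP; exists x; rewrite ?net_verts ?inE //.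
  by rewrite -/(without x y) without_sym.
Qed.

Lemma cut_edgeP e : e \in cut_edges N -> exists x y, cut x y /\ e = [set x; y].
Proof.
move=> ce; move: (ce); rewrite inE => /andP[eN _].
have [x [y [_ xy E]]] := edgeP (@net_simple _ N) eN; exists x, y.
by rewrite /cut -E.
Qed.

Lemma far_label x y : cut x y -> exists a, label N a \in far x y.
Proof.
move=> cxy; have := net_split_nonempty cxy; rewrite edge_splitE // !inE negb_or.
case/andP; rewrite eq_sym => /set0Pn[a]; rewrite inE => aF _.
by exists a.
Qed.

Lemma uniq_path_cut u p1 z p2 :
  path (adj N) u (p1 ++ z :: p2) -> uniq (u :: p1 ++ z :: p2) ->
  cut (last u p1) z -> (u \notin far (last u p1) z) /\ last z p2 \in far (last u p1) z.
Proof.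
set y := last u p1; rewrite cat_path => /andP[pp1 /andP[yz pp2]].
rewrite -cat_cons cat_uniq => /and3P[u1 /hasPn dis u2] cyz.
have avoid v (q : seq (vertex N)) t : t \notin v :: q -> (t == y) || (t == z) ->
    path (adj N) v q -> path (without y z) v q.
  move=> + ht; elim: q v => //= w q IH v; rewrite !inE !negb_or.
  case/and3P=> tv tw tq /andP[vw pw]; rewrite withoutE vw IH ?inE ?negb_or ?tw //=.
  rewrite andbT; apply/eqP => E.
  have : t \in [set v; w] by rewrite E !inE.
  by rewrite !inE (negPf tv) (negPf tw).
have y1 : y \in u :: p1 by apply: mem_last.
split.
  have : connect (without y z) u y.
    apply/connectP; exists p1 => //; apply: (avoid u p1 z) => //; last by rewrite eqxx orbT.
    by apply: dis; rewrite mem_head.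
  rewrite inE connect_without_sym => cuy; apply/negP => cuz.
  have := far_base cyz; rewrite inE connect_without_sym.
  by rewrite (connect_trans cuy) // connect_without_sym.
rewrite inE; apply/connectP; exists p2 => //; apply: (avoid z p2 y) => //.
  by apply/negP => yp; move: (dis y yp); rewrite y1.
by rewrite eqxx.
Qed.

End CutEdges.

(** * Classes of the noncut edges are blobs *)

Section NoncutClasses.
Variables (X : finType) (N : network X).
Implicit Types u v w x y z : vertex N.
Local Notation nc := (@noncut X N).

Definition nc_class v : {set vertex N} := [set w | connect nc v w].

Lemma connect_noncut_sym : connect_sym nc.
Proof. exact: sym_connect_sym (@noncut_sym _ N). Qed.

Lemma nc_class_refl v : v \in nc_class v.
Proof. by rewrite inE connect0. Qed.

Lemma nc_class_step v x y : x \in nc_class v -> nc x y -> y \in nc_class v.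
Proof. by rewrite !inE => vx xy; apply: connect_trans vx (connect1 xy). Qed.

Lemma nc_class_connect v x y :
  x \in nc_class v -> y \in nc_class v -> connect nc x y.
Proof. by rewrite !inE => vx vy; apply: connect_trans vy; rewrite connect_noncut_sym. Qed.

(* A cut edge on a simple path separates its ends, so a simple path joining
   the ends of a noncut edge has only noncut edges. *)
Lemma noncut_cycle s t : nc s t ->
  exists p, [/\ path nc s p, path (without s t) s p & last s p = t].
Proof.
move=> nst; move: (nst) => /andP[st]; rewrite cutP st negbK.
case/connectP=> p0 /shortenP[p pp up _] Et; rewrite {p0}Et in nst st pp *.
set t' := last s p in nst st pp *; exists p; split=> //.
have pa : path (adj N) s p by apply: sub_path pp => a b; rewrite withoutE => /andP[].
have [//|[p1 [z [p2 [Ep rz nz]]]]] := path_relP nc pa.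
have cz : cut (last s p1) z by move: nz; rewrite /noncut rz negbK.
rewrite Ep in pa up; have [sF tF] := uniq_path_cut pa up cz.
move: sF; rewrite (far_noncut cz (connect1 nst)) /t' Ep last_cat /=.
by rewrite tF.
Qed.

Lemma nc_class_cut v (f g : vertex N -> nat) :
  (forall x, f x + g x = ind (nc_class v) x) ->
  (exists x, 0 < f x) -> (exists x, 0 < g x) -> 2 <= edge_weight nc f g.
Proof.
move=> fg [x fx] [y gy].
have inC z : (0 < f z) || (0 < g z) -> z \in nc_class v.
  by have := fg z; rewrite /ind; case: (z \in _) => //; clear; lia.
have gE z : z \in nc_class v -> ~~ (0 < f z) -> 0 < g z.
  by move=> zC; have := fg z; rewrite /ind zC; clear; lia.
have fN z : 0 < g z -> ~~ (0 < f z).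
  by have := fg z; rewrite /ind; case: (z \in _); clear; lia.
have xC : x \in nc_class v by apply: inC; rewrite fx.
have yC : y \in nc_class v by apply: inC; rewrite gy orbT.
have /connectP[p pp Ey] := nc_class_connect xC yC.
have [|p1 [t [p2 [Ep fs ft]]]] := path_exit (S := fun z => 0 < f z) pp fx.
  by rewrite -Ey fN.
move: pp; rewrite Ep cat_path /= => /and3P[_ nst _].
set s := last x p1 in fs nst.
have [q [ncq woq Et]] := noncut_cycle nst.
have [|q1 [u [q2 [Eq fw fu]]]] := path_exit (S := fun z => 0 < f z) ncq fs.
  by rewrite Et.
move: ncq woq; rewrite Eq !cat_path /= => /and3P[_ nwu _] /and3P[_ wwu _].
have sC : s \in nc_class v by apply: inC; rewrite fs.
have wC : last s q1 \in nc_class v by apply: inC; rewrite fw.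
apply: (edge_weight_ge2 nst nwu) => //.
- by apply: gE ft; apply: nc_class_step nst.
- by apply: gE fu; apply: nc_class_step nwu.
- apply/eqP => -[E1 E2]; move: wwu; rewrite withoutE -E1 -E2 eqxx.
  by rewrite andbF.
Qed.

Lemma nc_degE v w : w \in nc_class v ->
  edge_weight nc (ind1 w) (ind (nc_class v)) = #|[set y | nc w y]|.
Proof.
move=> wC; rewrite (edge_weightC (@noncut_sym _ N)) edge_weight_ind_ind1.
apply: eq_card => y; rewrite !inE noncut_sym andb_idl // => nwy.
by have := nc_class_step wC nwy; rewrite inE.
Qed.

Lemma nc_class_deg v w : w \in nc_class v -> 1 < #|nc_class v| ->
  2 <= #|[set y | nc w y]|.
Proof.
move=> wC; rewrite (cardsD1 w) wC ltnS => C1.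
have EC := ind_setD1 wC.
rewrite -(nc_degE wC) (eq_edge_weight _ (fun=> erefl) EC) edge_weightDr.
rewrite edge_weight_ind1_ind1 noncut_irr; apply: (nc_class_cut (v := v)).
- by move=> x; rewrite EC.
- by exists w; rewrite /ind1 eqxx.
- exact: ind_gt0.
Qed.

Lemma deg_split w : deg N w = #|[set y | nc w y]| + #|[set y | cut w y]|.
Proof.
rewrite deg_neighbors; last exact: net_simple.
rewrite -(cardsID [set y | nc w y]); congr (_ + _); apply: eq_card => y.
  by rewrite !inE andb_idl // => /andP[].
rewrite !inE /noncut; case wy: (adj N w y); rewrite ?negbK ?andbT //=.
by apply/esym/negbTE/negP => /cut_adj; rewrite wy.
Qed.

Definition nc_blob v : graph (vertex N) :=
  Graph (nc_class v)
    [set e in edges N | (e \notin cut_edges N) && (e \subset nc_class v)].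

Lemma adj_nc_blob v x y : adj (nc_blob v) x y = nc x y && (x \in nc_class v).
Proof.
rewrite {1}/adj /= inE; apply/and3P/andP => [[xy nxy]|[nxy xC]].
  rewrite subUset !sub1set => /andP[xC _]; split=> //; exact/andP.
have /andP[xy cxy] := nxy; split=> //.
by rewrite subUset !sub1set xC (nc_class_step xC nxy).
Qed.

Lemma nc_blob_simple v : is_simple (nc_blob v).
Proof.
move=> e; rewrite inE => /and3P[eN _ ->]; split=> //.
by have [] := @net_simple _ N e eN.
Qed.

Lemma nc_blob_connect v x y : x \in nc_class v -> y \in nc_class v ->
  connect (adj (nc_blob v)) x y.
Proof.
move=> xC yC; have /connectP[p pp ->] := nc_class_connect xC yC.
elim: p x xC pp {yC y} => [|z p IH] x xC /=; first by rewrite connect0.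
case/andP=> nxz pz; apply: connect_trans (IH z (nc_class_step xC nxz) pz).
by apply: connect1; rewrite adj_nc_blob nxz.
Qed.

(* If removing [z] left two parts, each would send two edges to [z], whose
   degree is at most three. *)
Lemma nc_blob_two_connected v : 1 < #|nc_class v| -> two_connected (nc_blob v).
Proof.
move=> C1; split.
  apply/andP; split; first by apply/set0Pn; exists v; apply: nc_class_refl.
  by apply/forall_inP => x xC; apply/forall_inP => y yC; apply: nc_blob_connect.
move=> z zC; rewrite /= in zC; set r := adj (del_vertex (nc_blob v) z).
have rE x y : r x y = [&& nc x y, x \in nc_class v, x != z & y != z].
  rewrite /r /adj /= inE -[_ \in edges (nc_blob v)]/(adj (nc_blob v) x y).
  by rewrite adj_nc_blob !inE negb_or !(eq_sym z) -andbA.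
apply/andP; split.
  by rewrite -card_gt0 /=; move: C1; rewrite (cardsD1 z) zC.
apply/forall_inP => x; rewrite !inE => /andP[xz xC].
apply/forall_inP => y; rewrite !inE => /andP[yz yC].
apply/negPn/negP => nxy; rewrite -/r in nxy.
have rC : connect_sym r := @connect_adj_sym _ _.
have rclass a b : connect r a b -> a \in nc_class v -> b \in nc_class v.
  move=> /connectP[p pp ->]; elim: p a pp => //= c p IH a /andP[+ pp] aC.
  by rewrite rE => /and4P[nac _ _ _]; apply: IH pp (nc_class_step aC nac).
pose S := [set w | (w != z) && connect r x w].
pose T := [set w in nc_class v | (w != z) && ~~ connect r x w].
have xC' : x \in nc_class v by rewrite inE.
have yC' : y \in nc_class v by rewrite inE.
have SC w : w \in S -> w \in nc_class v.
  by rewrite inE => /andP[_ c]; apply: rclass c xC'.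
have EC w : ind (nc_class v) w = ind S w + ind T w + ind1 z w.
  rewrite /ind /ind1; have := SC w; rewrite [w \in T]inE [w \in S]inE.
  have [->|wz] := eqVneq w z; first by rewrite /= zC.
  case: (connect r x w) => /=; first by move/(_ isT) ->.
  by case: (w \in _).
have exS : exists w, 0 < ind S w by exists x; rewrite /ind inE xz connect0.
have exT : exists w, 0 < ind T w by exists y; rewrite /ind inE yC' yz nxy.
have ex1 : exists w, 0 < ind1 z w by exists z; rewrite /ind1 eqxx.
have exr f g : (exists x, 0 < g x) -> exists x : vertex N, 0 < addf f g x.
  by case=> w gw; exists w; rewrite /addf ltn_addl.
have ST : edge_weight nc (ind S) (ind T) = 0.
  apply: edge_weight_eq0 => s t; rewrite /ind !inE => hs ht nst.
  move: hs ht; case: (s =P z) => // /eqP sz; case: (t =P z) => [_|/eqP tz].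
    by rewrite andbF.
  case xs: (connect r x s) => // _; case xt: (connect r x t); rewrite ?andbF //.
  rewrite (connect_trans xs) // in xt; apply: connect1; rewrite rE nst sz tz.
  by rewrite (rclass _ _ xs xC').
have cS : 2 <= edge_weight nc (ind S) (addf (ind T) (ind1 z)).
  apply: (nc_class_cut (v := v)) => //; last exact: exr.
  by move=> w; rewrite EC /addf addnA.
have cT : 2 <= edge_weight nc (ind T) (addf (ind S) (ind1 z)).
  apply: (nc_class_cut (v := v)) => //; last exact: exr.
  by move=> w; rewrite EC /addf addnA [ind T w + _]addnC.
have dz : edge_weight nc (ind1 z) (ind (nc_class v)) <= 3.
  rewrite nc_degE //; have := deg_split z; have := net_deg (n := N) z.
  by move: (deg N z) #|_| #|_| => d n1 n2; clear; lia.
rewrite (eq_edge_weight _ (fun=> erefl) EC) in dz.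
move: cS cT dz; rewrite -[fun x => _]/(addf (addf (ind S) (ind T)) (ind1 z)).
rewrite !edge_weightDr !(edge_weightC (@noncut_sym _ N) (ind1 z)).
rewrite (edge_weightC (@noncut_sym _ N) (ind T) (ind S)) ST; clear; lia.
Qed.

Lemma two_connected_noncut (K : graph (vertex N)) x y :
  subgraph K N -> two_connected K -> 3 <= #|verts K| -> adj K x y -> nc x y.
Proof.
move=> [sK _ /subsetP eK] [_ cK] K3 Kxy; have Nxy : adj N x y by apply: eK.
rewrite /noncut Nxy cutP Nxy negbK /=.
have [/subsetP sxy _] := sK _ Kxy.
have xK : x \in verts K by apply: sxy; rewrite !inE eqxx.
have yK : y \in verts K by apply: sxy; rewrite !inE eqxx orbT.
have /card_gt0P[z] : 0 < #|verts K :\ x :\ y|.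
  move: K3; rewrite (cardsD1 x) xK (cardsD1 y (_ :\ x)) !add1n !ltnS.
  by case: (y \in _) => //; rewrite add0n => /ltnW.
rewrite !inE => /and3P[zy zx zK].
have sub a b : a \in [set x; y] -> b \in [set x; y] -> a != b ->
    connect (without x y) z b.
  move=> aK bK ab; have aV : a \in verts K by apply: sxy.
  have za : z != a by move: aK; rewrite !inE => /orP[]/eqP ->.
  have /andP[_ /forall_inP/(_ z)] := cK a aV; rewrite !inE za zK.
  move=> /(_ isT)/forall_inP/(_ b); rewrite !inE eq_sym ab sxy // => /(_ isT).
  apply: connect_sub => c d; rewrite /adj /= inE => /andP[cd acd].
  apply: connect1; rewrite withoutE /adj /= eK //=.
  by apply: contraNneq acd => ->.
have xy : x != y by apply/eqP => E; rewrite E (adj_irr (@net_simple _ N)) in Nxy.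
apply: (@connect_trans _ _ z); last by apply: (sub x y) => //; rewrite !inE eqxx ?orbT.
rewrite connect_without_sym; apply: (sub y x); rewrite ?inE ?eqxx ?orbT //.
by rewrite eq_sym.
Qed.

Lemma nc_blob_is_blob v : 1 < #|nc_class v| -> is_blob N (nc_blob v).
Proof.
move=> C1.
have C3 : 3 <= #|nc_class v|.
  have vC := nc_class_refl v; have d2 := nc_class_deg vC C1.
  rewrite (cardsD1 v) vC ltnS; apply: leq_trans d2 _.
  apply/subset_leq_card/subsetP => y; rewrite inE => nvy; rewrite in_setD1.
  rewrite (nc_class_step vC nvy) andbT; apply/eqP => E.
  by rewrite E noncut_irr in nvy.
split=> //.
- split; first exact: nc_blob_simple.
  + by rewrite net_verts subsetT.
  + by apply/subsetP => e; rewrite inE => /andP[].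
- exact: nc_blob_two_connected.
move=> K sK tK [_ /= VK EK]; have K3 := leq_trans C3 (subset_leq_card VK).
have Knc x y := @two_connected_noncut K x y sK tK K3.
have [simK _ /subsetP eK] := sK.
have KC : verts K = nc_class v.
  apply/eqP; rewrite eqEsubset VK andbT; apply/subsetP => x xK.
  have vK : v \in verts K := subsetP VK _ (nc_class_refl v).
  have [/andP[_ /forall_inP cK] _] := tK.
  have /forall_inP/(_ x xK) c := cK v vK.
  have sub : subrel (adj K) (connect nc) by move=> a b Kab; exact/connect1/Knc.
  by rewrite inE; apply: (connect_sub sub) c.
case: K sK tK VK EK K3 Knc simK eK KC => VK' EK' /= sK tK VK EK K3 Knc simK eK KC.
rewrite /nc_blob KC; congr Graph; apply/eqP; rewrite eqEsubset EK andbT.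
apply/subsetP => e eE; rewrite inE eK //=.
have [x [y [_ xy Ee]]] := edgeP simK eE.
have [sub _] := simK _ eE; rewrite -KC sub andbT Ee.
by have /andP[] := Knc _ _ xy.
Qed.

Lemma nc_class_branching v : level_le 2 N -> 1 < #|nc_class v| ->
  #|[set w in nc_class v | #|[set y | nc w y]| == 3]| <= 2.
Proof.
have arith d e c p : d <= 2 -> e - d < c -> c * 2 + p = 2 * e -> p <= 2 by lia.
move=> lev C1; have [D [DE D2 [_ acD]]] := lev _ (nc_blob_is_blob C1).
set T := del_edges _ _ in acD.
have sT : is_simple T by move=> e; rewrite inE => /andP[_ /nc_blob_simple].
have V0 : verts T != set0 by apply/set0Pn; exists v; apply: nc_class_refl.
have := acyclic_card_edges sT acD V0; rewrite /= cardsD (setIidPr DE) => cE.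
have := handshake (@nc_blob_simple v).
rewrite (eq_bigr (fun w => 2 + (#|[set y | nc w y]| == 3))); last first.
  move=> w wC; rewrite deg_neighbors; last exact: nc_blob_simple.
  rewrite (_ : [set y | _] = [set y | nc w y]); last first.
    by apply/setP => y; rewrite !inE adj_nc_blob wC andbT.
  have d3 : deg N w <= 3 by case: (net_deg (n := N) w) => ->.
  have : #|[set y | nc w y]| <= 3 by apply: leq_trans d3; rewrite deg_split leq_addr.
  by have := nc_class_deg wC C1; case: #|_| => [|[|[|[|n]]]].
rewrite big_split sum_nat_const /= -big_mkcondr sum1_card.
rewrite [X in _ + X](_ : _ = #|[set w in nc_class v | #|[set y | nc w y]| == 3]|).
  by apply: arith D2 cE.
by apply: eq_card => w; rewrite [RHS]inE.
Qed.

End NoncutClasses.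

(** * Splits *)

Section Splits.
Variables (X : finType) (N : network X).
Implicit Types (A B : {set X}) (u v w x y z : vertex N).
Local Notation nc := (@noncut X N).

Definition split_condition A B : Prop :=
  forall a a' b b' : X, a \in A -> a' \in A -> b \in B -> b' \in B ->
    dm N a b + dm N a' b' = dm N a b' + dm N a' b /\
    dm N a a' + dm N b b' + 2 <= dm N a b + dm N a' b'.

Lemma cut_is_split x y : cut x y ->
  is_split (label N @^-1: far x y) (label N @^-1: far y x).
Proof.
move=> cxy; split.
- by have [a aF] := far_label cxy; apply/set0Pn; exists a; rewrite inE.
- have [|b bF] := far_label (x := y) (y := x); first by rewrite cut_sym.
  by apply/set0Pn; exists b; rewrite inE.
- by rewrite (far_compl cxy) preimsetC setUCr.
- by rewrite (far_compl cxy) preimsetC -setI_eq0 setICr.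
Qed.

Lemma cut_split_condition x y : cut x y ->
  split_condition (label N @^-1: far x y) (label N @^-1: far y x).
Proof.
move=> cxy a a' b b'; rewrite (far_compl cxy) !inE => aF a'F bF b'F.
rewrite /dm -!/(dist _ _).
have inF c : connect (without x y) y (label N c) -> label N c \in far x y by rewrite inE.
have notF c : ~~ connect (without x y) y (label N c) -> label N c \notin far x y.
  by rewrite inE.
move: aF a'F bF b'F => /inF aF /inF a'F /notF bF /notF b'F.
rewrite (dist_cut cxy aF bF) (dist_cut cxy aF b'F).
rewrite (dist_cut cxy a'F bF) (dist_cut cxy a'F b'F).
have := dist_triangle y (label N a) (label N a').
have := dist_triangle x (label N b) (label N b').
rewrite (dist_sym _ x) (dist_sym y).
by clear; lia.
Qed.

Lemma far_subset u v w x : cut u v -> x \in far u v -> v \notin far w x ->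
  far w x \subset far u v.
Proof.
move=> cuv xF vF; apply/subsetP => z; rewrite inE => /connectP[p pp ->].
apply/negPn/negP => zF.
have [p1 [t [p2 [Ep S1 S2]]]] := path_exit (S := mem (far u v)) pp xF zF.
move: pp; rewrite Ep cat_path /= => /and3P[pp1 lt _].
have at' : adj N (last x p1) t by move: lt; rewrite withoutE => /andP[].
have [Ev _] := far_cross cuv S1 S2 at'.
by case/negP: vF; rewrite inE -Ev; apply/connectP; exists p1.
Qed.

Lemma nc_class_far v w x y : cut x y -> w \in nc_class v ->
  (v \in far x y) = (w \in far x y).
Proof. by rewrite inE => cxy; apply: far_noncut. Qed.

Lemma nc_class_adj v x y : x \in nc_class v -> y \in nc_class v ->
  adj N x y -> nc x y.
Proof.
move=> xC yC xy; rewrite /noncut xy /=; apply/negP => cxy.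
have := far_base cxy; rewrite -(nc_class_far cxy xC) (nc_class_far cxy yC).
by rewrite far_tip.
Qed.

Lemma nc_class_cover v z : z \notin nc_class v ->
  exists w x, [/\ w \in nc_class v, cut w x & z \in far w x].
Proof.
move=> zC; have [p [pp up lp _]] := dist_path v z.
have [|p1 [t [p2 [Ep S1 S2]]]] :=
  path_exit (S := mem (nc_class v)) pp (nc_class_refl v); first by rewrite lp.
rewrite Ep in pp up; have at' : adj N (last v p1) t.
  by move: pp; rewrite cat_path /= => /and3P[].
have ct : cut (last v p1) t.
  apply/negPn/negP => nct; case/negP: S2; apply: nc_class_step S1 _.
  by rewrite /noncut at' nct.
have [_] := uniq_path_cut pp up ct; move: lp; rewrite Ep last_cat /= => -> zF.
by exists (last v p1), t.
Qed.

Lemma nc_class_branches_disjoint v w x w' x' :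
  w \in nc_class v -> w' \in nc_class v -> w != w' -> cut w x -> cut w' x' ->
  far w' x' \subset ~: far w x.
Proof.
move=> wC w'C ww' cwx cwx'; rewrite -(far_compl cwx); apply: far_subset.
- by rewrite cut_sym.
- rewrite (far_compl cwx) inE; apply/negP => x'F.
  have w'F : w' \notin far w x.
    by rewrite -(nc_class_far cwx w'C) (nc_class_far cwx wC) far_base.
  have [] := far_cross cwx x'F w'F; first by rewrite adj_sym cut_adj.
  by move=> _ E; rewrite E eqxx in ww'.
- by rewrite -(nc_class_far cwx' wC) (nc_class_far cwx' w'C) far_base.
Qed.

Lemma dist_branches v w x w' x' l l' :
  w \in nc_class v -> w' \in nc_class v -> w != w' -> cut w x -> cut w' x' ->
  l \in far w x -> l' \in far w' x' ->
  dist l l' = (dist l x + 1) + dist w w' + (dist l' x' + 1).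
Proof.
move=> wC w'C ww' cwx cwx' lF l'F.
have dis := nc_class_branches_disjoint wC w'C ww' cwx cwx'.
have l'F' : l' \notin far w x by have := subsetP dis _ l'F; rewrite inE.
have wF : w \notin far w' x'.
  by rewrite -(nc_class_far cwx' wC) (nc_class_far cwx' w'C) far_base.
rewrite (dist_cut cwx lF l'F') (dist_sym w l') (dist_cut cwx' l'F wF).
by rewrite (dist_sym w' w); lia.
Qed.

Lemma leaf_cut w : deg N w = 1 -> exists x, cut w x.
Proof.
move=> d1; have := deg_split w; rewrite d1.
have [nd0|/card_gt0P[y]] := posnP #|[set y | nc w y]|.
  rewrite nd0 add0n => cd1; have /card_gt0P[x] : 0 < #|[set y | cut w y]|.
    by rewrite -cd1.
  by rewrite inE => cwx; exists x.
rewrite inE => nwy; have wC := nc_class_refl w.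
have C1 : 1 < #|nc_class w|.
  rewrite (cardsD1 w) wC ltnS card_gt0; apply/set0Pn; exists y.
  rewrite in_setD1 (nc_class_step wC nwy) andbT; apply/eqP => E.
  by rewrite E noncut_irr in nwy.
by have := nc_class_deg wC C1; move: #|_| => [|[|n]].
Qed.

Record uninduced A B : Prop := Uninduced {
  un_split : is_split A B;
  un_cond : split_condition A B;
  un_cut : forall x y, cut x y -> edge_split N (label N) [set x; y] <> [set A; B]
}.

Lemma uninduced_sym A B : uninduced A B -> uninduced B A.
Proof.
case=> -[A0 B0 AB dAB] cond nocut; split.
- by split; rewrite // 1?setUC // disjoint_sym.
- move=> b b' a a' bB b'B aA a'A; have [] := cond a a' b b' aA a'A bB b'B.
  rewrite /dm -!/(dist _ _) !(dist_sym (label N b) (label N a)).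
  rewrite !(dist_sym (label N b') (label N a')) (dist_sym (label N b) (label N a')).
  by rewrite (dist_sym (label N b') (label N a)); clear; lia.
- by move=> x y cxy; rewrite (setUC [set B]); apply: nocut.
Qed.

Definition mono A B (S : {set vertex N}) : bool :=
  (label N @^-1: S \subset A) || (label N @^-1: S \subset B).

Lemma mono_sym A B S : mono A B S = mono B A S.
Proof. exact: orbC. Qed.

Section Uninduced.
Variables A B : {set X}.
Hypothesis U : uninduced A B.

Lemma un_AB c : (c \in B) = (c \notin A).
Proof.
have [_ _ AB /pred0P dAB] := un_split U; have := dAB c; have := in_setT c.
by rewrite -AB inE /=; case: (c \in A); case: (c \in B).
Qed.

Lemma un_not_mono S : ~~ mono A B S ->
  exists a b, [/\ a \in A, b \in B, label N a \in S & label N b \in S].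
Proof.
rewrite negb_or => /andP[/subsetPn[b + bA] /subsetPn[a + aB]].
rewrite !inE => bS aS; exists a, b; rewrite un_AB bA; split=> //.
by move: aB; rewrite un_AB negbK.
Qed.

Lemma un_mono_one x y : cut x y -> mono A B (far x y) || mono A B (far y x).
Proof.
move=> cxy; apply/negPn/negP; rewrite negb_or => /andP[/un_not_mono[a [b]]].
case=> aA bB aF bF /un_not_mono[a' [b' [a'A b'B]]].
rewrite (far_compl cxy) !in_setC => a'F b'F.
have [] := un_cond U aA a'A bB b'B; rewrite /dm -!/(dist _ _).
rewrite (dist_sym (label N a') (label N b)).
rewrite (dist_cut cxy aF a'F) (dist_cut cxy bF b'F) (dist_cut cxy aF b'F).
rewrite (dist_cut cxy bF a'F).
by clear; lia.
Qed.

Lemma un_mono_both x y : cut x y -> mono A B (far x y) -> mono A B (far y x) ->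
  False.
Proof.
move=> cxy; have [A0 B0 _ _] := un_split U; have spE := edge_splitE cxy.
have inor c : (label N c \in far x y) || (label N c \in far y x).
  by rewrite (far_compl cxy) in_setC orbN.
case/orP=> /subsetP m1 /orP[]/subsetP m2.
- case/set0Pn: B0 => b; rewrite un_AB => /negP; apply.
  by case/orP: (inor b) => h; [apply: m1|apply: m2]; rewrite inE.
- apply: (un_cut U cxy); rewrite spE; congr [set _; _]; apply/eqP.
  + rewrite eqEsubset; apply/andP; split; apply/subsetP => c; first exact: m1.
    move=> cA; rewrite inE; case/orP: (inor c) => // cF.
    by have := m2 c; rewrite inE cF un_AB cA => /(_ isT).
  + rewrite eqEsubset; apply/andP; split; apply/subsetP => c; first exact: m2.
    move=> cB; rewrite inE; case/orP: (inor c) => // cF.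
    by have := m1 c; rewrite inE cF => /(_ isT) cA; rewrite un_AB cA in cB.
- apply: (un_cut U cxy); rewrite spE (setUC [set A]); congr [set _; _]; apply/eqP.
  + rewrite eqEsubset; apply/andP; split; apply/subsetP => c; first exact: m1.
    move=> cB; rewrite inE; case/orP: (inor c) => // cF.
    by have := m2 c; rewrite inE cF => /(_ isT) cA; rewrite un_AB cA in cB.
  + rewrite eqEsubset; apply/andP; split; apply/subsetP => c; first exact: m2.
    move=> cA; rewrite inE; case/orP: (inor c) => // cF.
    by have := m1 c; rewrite inE cF un_AB cA => /(_ isT).
- case/set0Pn: A0 => a aA; have : a \in B.
    by case/orP: (inor a) => h; [apply: m1|apply: m2]; rewrite inE.
  by rewrite un_AB aA.
Qed.

(* A two-coloured side [far u v] of minimal size: all other branches at the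
   class of [v] lie strictly inside it. *)
Lemma un_center : exists v, deg N v = 3 /\
  forall w x, w \in nc_class v -> cut w x -> mono A B (far w x).
Proof.
pose Q (p : vertex N * vertex N) := cut p.1 p.2 && ~~ mono A B (far p.1 p.2).
have [p0 Qp0] : exists p0, Q p0.
  have [/set0Pn[a _] _ _ _] := un_split U.
  have /leaf_cut[y cy] : deg N (label N a) = 1 by apply/label_leaves; exists a.
  have [m1|m1] := boolP (mono A B (far (label N a) y)); last first.
    by exists (label N a, y); rewrite /Q /= cy m1.
  exists (y, label N a); rewrite /Q /= cut_sym cy /=.
  by apply/negP; apply: un_mono_both m1.
case: (arg_minnP (fun p => #|far p.1 p.2|) Qp0) => -[u v] /andP[/= cuv nm] minuv.
exists v; split.
  case: (net_deg (n := N) v) => // d1.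
  have vu : adj N v u by rewrite adj_sym cut_adj.
  have [a [b [aA bB aF bF]]] := un_not_mono nm.
  have only z : z \in far u v -> z = v.
    rewrite inE => /connectP[[|t p] /=]; first by move=> _ ->.
    case/andP; rewrite withoutE => /andP[vt ne] _ _.
    move: d1; rewrite deg_neighbors; last exact: net_simple.
    move=> /eqP/cards1P[s Es].
    have : t \in [set s] by rewrite -Es inE.
    have : u \in [set s] by rewrite -Es inE.
    rewrite !inE => /eqP us /eqP ts; move: ne; rewrite ts us setUC eqxx.
    by [].
  have E : a = b by apply: (@label_inj _ N); rewrite (only _ aF) (only _ bF).
  by move: bB; rewrite un_AB -E aA.
move=> w x wC cwx.
have [/set2_eqP[][Ew Ex]|ne] := eqVneq [set w; x] [set u; v].
- have := far_base cuv; rewrite -Ew -(nc_class_far _ wC) ?Ew //.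
  by rewrite far_tip.
- by rewrite Ew Ex; move: (un_mono_one cuv); rewrite (negPf nm).
apply/negPn/negP => nmw.
have wF : w \in far u v by rewrite -(nc_class_far cuv wC) far_tip.
have vF : v \notin far w x by rewrite (nc_class_far cwx wC) far_base.
have xF : x \in far u v.
  apply/negPn/negP => xF; have [Ew Ex] := far_cross cuv wF xF (cut_adj cwx).
  by rewrite Ew Ex setUC eqxx in ne.
have : #|far w x| < #|far u v|.
  apply: proper_card; apply/properP; split; first exact: far_subset.
  by exists v; rewrite ?far_tip.
by rewrite ltnNge (minuv (w, x)) // /Q /= cwx.
Qed.

Variable v : vertex N.
Hypothesis v3 : deg N v = 3.
Hypothesis v_mono : forall w x, w \in nc_class v -> cut w x -> mono A B (far w x).

Definition branches : {set vertex N * vertex N} :=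
  [set p | (p.1 \in nc_class v) && cut p.1 p.2].

Definition branches_in (D : {set X}) : {set vertex N * vertex N} :=
  [set p in branches | label N @^-1: far p.1 p.2 \subset D].

Lemma class_deg3 w : w \in nc_class v -> deg N w = 3.
Proof.
move=> wC; case: (net_deg (n := N) w) => // d1.
have [C1|C1] := leqP #|nc_class v| 1.
  by have -> : w = v by apply: (card_le1_eqP C1) => //; apply: nc_class_refl.
have := nc_class_deg wC C1; have := deg_split w; rewrite d1.
by move: #|_| => [|[|n]].
Qed.

Lemma label_branch l : exists2 p, p \in branches & label N l \in far p.1 p.2.
Proof.
have lC : label N l \notin nc_class v.
  apply/negP => /class_deg3; have : deg N (label N l) = 1 by apply/label_leaves; exists l.
  by move=> ->.
have [w [x [wC cwx lF]]] := nc_class_cover lC; exists (w, x) => //.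
by rewrite in_set /= wC.
Qed.

Lemma branches_AB p : p \in branches -> (p \in branches_in B) = (p \notin branches_in A).
Proof.
move=> pb; rewrite ![p \in branches_in _]inE pb /=.
move: pb; rewrite inE => /andP[pC cp].
have [a] := far_label cp => aF; have /orP := v_mono pC cp.
have [sA|nA] /= := boolP (_ \subset A); last by case.
move=> _; apply/negP => /subsetP/(_ a); rewrite inE aF un_AB => /(_ isT)/negP; apply.
by apply: (subsetP sA); rewrite inE.
Qed.

Lemma card_branches_in : 1 < #|branches_in A|.
Proof.
rewrite ltnNge leq_eqVlt ltnS leqn0 cards_eq0; apply/negP.
have inB l p : p \in branches -> p \notin branches_in A -> label N l \in far p.1 p.2 ->
    l \in B.
  move=> pb; rewrite -branches_AB // inE => /andP[_ /subsetP sub] lF.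
  by apply: sub; rewrite inE.
case/orP=> [/cards1P[[w x] E]|/eqP E].
  have : (w, x) \in branches_in A by rewrite E inE.
  rewrite inE inE /= => /andP[/andP[wC cwx] sA].
  apply: (un_mono_both cwx); first by rewrite /mono sA.
  apply/orP; right; apply/subsetP => l; rewrite inE (far_compl cwx) in_setC => lF.
  have [p pb lp] := label_branch l; apply: (inB l p) => //.
  by rewrite E inE; apply: contraNneq lF => Ep; rewrite Ep in lp.
have [/set0Pn[a aA] _ _ _] := un_split U.
have [p pb lp] := label_branch a; have : a \in B by apply: (inB a p) => //; rewrite E inE.
by rewrite un_AB aA.
Qed.

End Uninduced.

Lemma uninduced_false A B : level_le 2 N -> ~ uninduced A B.
Proof.
move=> lev U; have [v [v3 v_mono]] := un_center U.
have U' := uninduced_sym U.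
have v_mono' w x : w \in nc_class v -> cut w x -> mono B A (far w x).
  by rewrite mono_sym; apply: v_mono.
have cA := card_branches_in U v3 v_mono; have cB := card_branches_in U' v3 v_mono'.
have disAB p : p \in branches_in v A -> p \in branches_in v B -> False.
  by move=> pA; move: (pA); rewrite inE => /andP[pb _]; rewrite (branches_AB U v_mono pb) pA.
have [C1|C1] := leqP #|nc_class v| 1.
  have sub : branches_in v A :|: branches_in v B \subset [set (v, y) | y in [set y | cut v y]].
    apply/subsetP => -[w x] wxb; have : (w, x) \in branches v.
      by move: wxb; rewrite !inE => /orP[]/andP[].
    rewrite !inE /= -[connect _ _ _](in_set (connect nc v)) => /andP[wC cwx].
    have Ew : w = v by apply: (card_le1_eqP C1); rewrite ?nc_class_refl // inE.
    by apply/imsetP; exists x; rewrite ?inE -Ew.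
  have := subset_leq_card sub; rewrite card_imset; last by move=> y z [].
  rewrite cardsU (_ : _ :&: _ = set0) ?cards0 ?subn0; last first.
    by apply/setP => p; rewrite in_setI in_set0; apply/negP => /andP[]; apply: disAB.
  have := deg_split v; rewrite v3; move: cA cB.
  move: #|branches_in v A| #|branches_in v B| => nA nB; clear; lia.
pose nd w := #|[set y | nc w y]|.
have ndcd w : w \in nc_class v -> nd w + #|[set y | cut w y]| = 3.
  by move=> wC; rewrite -deg_split (class_deg3 v3 wC).
have nd2 w : w \in nc_class v -> 2 <= nd w by move=> wC; apply: nc_class_deg wC C1.
have fst_inj : {in branches v &, injective (fun p : vertex N * vertex N => p.1)}.
  move=> [w x] [w' x']; rewrite !in_set /= => /andP[wC cwx] /andP[_ cwx'] Ew.
  rewrite -Ew in cwx' *; congr pair.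
  have wC' : w \in nc_class v by rewrite in_set.
  have : #|[set y | cut w y]| <= 1 by move: (ndcd w wC') (nd2 w wC'); clear; lia.
  by move/card_le1_eqP; apply; rewrite inE.
pose color D := [set p.1 | p in branches_in v D].
pose P := [set w in nc_class v | nd w == 3].
have sub_branches D p : p \in branches_in v D -> p \in branches v.
  by rewrite inE => /andP[].
have cardc D : #|color D| = #|branches_in v D|.
  apply: card_in_imset => p q /sub_branches pb /sub_branches qb; exact: fst_inj.
have colorP D w : w \in color D -> exists x, [/\ w \in nc_class v, cut w x &
    label N @^-1: far w x \subset D].
  case/imsetP=> -[w' x]; rewrite 2!in_set /= => /andP[/andP[wC cwx] sD] ->.
  by exists x.
have colorC D w : w \in color D -> w \in nc_class v by case/colorP=> x [].
have color_leaf D w : w \in color D -> exists x l, [/\ l \in D, cut w x &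
    label N l \in far w x].
  case/colorP=> x [_ cwx sD]; have [l lF] := far_label cwx; exists x, l; split=> //.
  by apply: (subsetP sD); rewrite inE.
have color_nd D w : w \in color D -> nd w = 2.
  case/colorP=> x [wC cwx _]; have := ndcd w wC; have := nd2 w wC.
  have : 0 < #|[set y | cut w y]| by apply/card_gt0P; exists x; rewrite inE.
  clear; lia.
have indC w : ind (nc_class v) w = ind (color A) w + ind (color B) w + ind P w.
  rewrite /ind; have [wA|wA] := boolP (w \in color A).
    have /negPf -> : w \notin P by rewrite in_set (color_nd _ _ wA) andbF.
    suff /negPf -> : w \notin color B by rewrite (colorC _ _ wA).
    apply/negP; move: wA => /imsetP[p pA ->] /imsetP[q qB E].
    have Epq := fst_inj _ _ (sub_branches _ _ pA) (sub_branches _ _ qB) E.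
    by apply: (disAB p) => //; rewrite Epq.
  have [wB|wB] := boolP (w \in color B).
    have /negPf -> : w \notin P by rewrite in_set (color_nd _ _ wB) andbF.
    by rewrite (colorC _ _ wB).
  rewrite [w \in P]in_set !add0n; congr nat_of_bool; apply/esym/andb_idr => wC.
  have := ndcd w wC; have := nd2 w wC; case: (posnP #|[set y | cut w y]|).
    by move=> ->; rewrite addn0 => _ ->.
  case/card_gt0P=> x; rewrite inE => cwx.
  have wxb : (w, x) \in branches v by rewrite in_set /= wC.
  have [wxA|wxA] := boolP ((w, x) \in branches_in v A).
    by case/negP: wA; apply/imsetP; exists (w, x).
  by case/negP: wB; apply/imsetP; exists (w, x); rewrite ?(branches_AB U v_mono).
have EC : color A :|: color B :|: P = nc_class v.
  apply/setP => w; have := indC w; rewrite /ind 2!in_setU.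
  by case: (w \in nc_class v); case: (w \in color A); case: (w \in color B);
    case: (w \in P).
have colorsC w : w \in color A :|: color B -> w \in nc_class v.
  by rewrite inE => /orP[]; apply: colorC.
apply: (@bicolored_blob_false _ nc (@dist _ N) (color A) (color B) P).
have four a a' b b' : a \in color A -> a' \in color A -> b \in color B ->
    b' \in color B -> a != a' -> b != b' ->
    dist a b + dist a' b' = dist a b' + dist a' b /\
    dist a a' + dist b b' + 2 <= dist a b + dist a' b'.
  move=> aA a'A bB b'B aa bb.
  have neAB c d : c \in color A -> d \in color B -> c != d.
    move=> cA' dB; apply/eqP => E; have := indC c.
    by rewrite /ind cA' {2}E dB (colorC _ _ cA').
  have [xa [la [laA ca faa]]] := color_leaf _ _ aA.
  have [xa' [la' [la'A ca' fa']]] := color_leaf _ _ a'A.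
  have [xb [lb [lbB cb fb]]] := color_leaf _ _ bB.
  have [xb' [lb' [lb'B cb' fb']]] := color_leaf _ _ b'B.
  have := un_cond U laA la'A lbB lb'B; rewrite /dm -!/(dist _ _).
  have [aC a'C] := (colorC _ _ aA, colorC _ _ a'A).
  have [bC b'C] := (colorC _ _ bB, colorC _ _ b'B).
  rewrite (dist_branches aC bC (neAB _ _ aA bB) ca cb faa fb).
  rewrite (dist_branches a'C b'C (neAB _ _ a'A b'B) ca' cb' fa' fb').
  rewrite (dist_branches aC b'C (neAB _ _ aA b'B) ca cb' faa fb').
  rewrite (dist_branches a'C bC (neAB _ _ a'A bB) ca' cb fa' fb).
  rewrite (dist_branches aC a'C aa ca ca' faa fa').
  rewrite (dist_branches bC b'C bb cb cb' fb fb').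
  by clear; lia.
split.
- exact: noncut_sym.
- exact: noncut_irr.
- by move=> w; rewrite -indC leq_b1.
- move=> w; rewrite EC => wC; rewrite nc_degE // /ind inE wC /= -/(nd w).
  have := ndcd w wC; have := nd2 w wC; clear.
  by case: (nd w) => [|[|[|[|n]]]].
- exact: nc_class_branching.
- by rewrite cardc.
- by rewrite cardc.
- by move=> f g fg; apply: (nc_class_cut (v := v)) => w; rewrite fg indC.
- exact: dist_sym.
- exact: dist_gt0.
- by move=> x y /andP[xy _]; apply: dist_adj.
- move=> x z y /andP[/dist_adj xz _] /andP[/dist_adj zy _].
  by apply: leq_trans (dist_triangle z x y) (leq_add xz zy).
- move=> x y /colorsC xC /colorsC yC xy /(dist1_inv xy).
  exact: nc_class_adj xC yC.
- move=> x y /colorsC xC /colorsC yC xy /(dist2_inv xy)[xy1|[z [xz zy]]].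
    by left; apply: nc_class_adj xC yC xy1.
  right; exists z; rewrite EC.
  have [cxz|ncxz] := boolP (cut x z).
    have yF : y \notin far x z.
      by rewrite -(nc_class_far cxz yC) (nc_class_far cxz xC) far_base.
    have [_ E] := far_cross cxz (far_tip x z) yF zy.
    by rewrite E eqxx in xy.
  have nxz : nc x z by rewrite /noncut xz.
  have zC := nc_class_step xC nxz; split=> //.
  exact: nc_class_adj zC yC zy.
- by move=> a a' b b' aA a'A bB b'B aa bb; have [] := four _ _ _ _ aA a'A bB b'B aa bb.
- by move=> a a' b b' aA a'A bB b'B aa bb; have [] := four _ _ _ _ aA a'A bB b'B aa bb.
Qed.

End Splits.

Theorem theorem2 (X : finType) :
  (forall N : network X, level_le 2 N ->
     forall A B : {set X}, is_split A B ->
       ((exists2 e, e \in cut_edges N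
                  & edge_split N (label N) e = [set A; B]) <->
        (forall a a' b b' : X, a \in A -> a' \in A -> b \in B -> b' \in B ->
           dm N a b + dm N a' b' = dm N a b' + dm N a' b /\
           dm N a a' + dm N b b' + 2 <= dm N a b + dm N a' b')))
  /\
  (exists splits_of : {ffun X * X -> nat} -> {set {set {set X}}},
     forall N : network X, level_le 2 N ->
       cut_splits N = splits_of (dist_matrix N)).
Proof.
have part1 (N : network X) : level_le 2 N -> forall A B : {set X}, is_split A B ->
    ((exists2 e, e \in cut_edges N & edge_split N (label N) e = [set A; B]) <->
     split_condition N A B).
  move=> lev A B sAB; split=> [[e ce]|cond].
    have [x [y [cxy ->]]] := cut_edgeP ce; rewrite edge_splitE //.
    case/set2_eqP=> [[<- <-]|[<- <-]]; first exact: cut_split_condition.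
    by apply: cut_split_condition; rewrite cut_sym.
  have [/exists_inP[e ce /eqP E]|none] :=
    boolP [exists e in cut_edges N, edge_split N (label N) e == [set A; B]].
    by exists e.
  case: (@uninduced_false _ N A B lev); split=> // x y cxy E.
  by case/negP: none; apply/exists_inP; exists [set x; y]; rewrite // E.
split; first exact: part1.
exists (fun D => [set s : {set {set X}} | [exists A : {set X}, exists B : {set X},
  [&& s == [set A; B], A != set0, B != set0, A :|: B == setT, [disjoint A & B] &
   [forall a in A, forall a' in A, forall b in B, forall b' in B,
     (D (a, b) + D (a', b') == D (a, b') + D (a', b)) &&
     (D (a, a') + D (b, b') + 2 <= D (a, b) + D (a', b'))]]]]) => N lev.
apply/setP => s; rewrite inE; apply/imsetP/existsP => [[e ce ->]|[A /existsP[B]]].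
  have [x [y [cxy ->]]] := cut_edgeP ce; rewrite edge_splitE //.
  have [A0 B0 AB dAB] := cut_is_split cxy.
  exists (label N @^-1: far x y); apply/existsP; exists (label N @^-1: far y x).
  rewrite eqxx A0 B0 AB eqxx dAB /=.
  apply/forall_inP => a aA; apply/forall_inP => a' a'A.
  apply/forall_inP => b bB; apply/forall_inP => b' b'B.
  have [E1 E2] := cut_split_condition cxy aA a'A bB b'B.
  by rewrite /dist_matrix !ffunE /= E2 andbT; apply/eqP.
case/and5P=> /eqP -> A0 B0 /eqP AB /andP[dAB /forall_inP cond].
have cond' : split_condition N A B.
  move=> a a' b b' aA a'A bB b'B.
  have /forall_inP/(_ a' a'A)/forall_inP/(_ b bB)/forall_inP/(_ b' b'B) := cond a aA.
  by rewrite /dist_matrix !ffunE /= => /andP[/eqP].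
have sAB : is_split A B by split.
by have [_ /(_ cond')[e ce E]] := part1 N lev A B sAB; exists e.
Qed.
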